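(* Let $P$ be the transition kernel of a $\pi$-irreducible Markov chain that is reversible with respect to its invariant probability measure $\pi$ and non-negative definite. Assume that there exist a set $A\in\mathscr{B}(X)$ with $\pi(A)>0$ and a constant $\kappa>1$ such that, for some constant $\delta>0$ and some probability measure $\nu$ on $\mathscr{B}(X)$, $$P(x,B)\ge\delta1_A(x)\nu(B),\qquad x\in X,\ B\in\mathscr{B}(X),$$ and $L:=\sup_{x\in A}\mathbb{E}_x[\kappa^{\tau_A}]<\infty$. Then for $\pi$-a.s. $x\in X$ there exists a constant $C(x)<\infty$ such that (for all $n$) $$\|P^n(x,\cdot)-\pi\|_{\mathrm{Var}}\le C(x)K^{-n},$$ where $$K=\kappa\wedge(1-\delta)^{-1/\alpha},\qquad \alpha=\Bigl(\log\frac{L-\delta\kappa}{1-\delta}\Bigr)\Big/(\log\kappa).$$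
   Context: $\Phi=\{\Phi_n:n\in\mathbb{Z}_+\}$ is a discrete-time homogeneous Markov chain on a general state space $X$ with countably generated $\sigma$-field $\mathscr{B}(X)$ and $n$-step transition kernel $P^n(x,B)=\mathbb{P}_x\{\Phi_n\in B\}$; $\mathbb{P}_x,\mathbb{E}_x$ are probability and expectation given $\Phi_0=x$. The chain has a (unique) invariant probability measure $\pi$ and is $\pi$-irreducible: if $\pi(B)>0$, there exists $n\in\mathbb{N}$ such that $P^n(x,B)>0$ for all $x\in X$. It is assumed that $P^n(x,\cdot)\ll\pi$ ($n\ge1$), with density $p^n(x,y)$. Reversible: $\pi(dx)P(x,dy)=\pi(dy)P(y,dx)$. Non-negative definite: $\int_X f(x)Pf(x)\,\pi(dx)\ge0$ for all $f\in L^2(\pi,X)$, where $Pf(x)=\int f(y)P(x,dy)$. $\tau_A=\inf\{n\ge1:\Phi_n\in A\}$. $\|\mu\|_{\mathrm{Var}}=\sup_{|f|\le1}|\mu(f)|$ for a signed measure $\mu$. $a\wedge b=\min\{a,b\}$. *)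

(* Defs.v *)
From HB Require Import structures.
From mathcomp Require Import all_boot all_order all_algebra.
From mathcomp Require Import all_classical all_reals all_analysis.

Set Implicit Arguments.
Unset Strict Implicit.
Unset Printing Implicit Defensive.

Import Order.TTheory GRing.Theory Num.Theory.
Import numFieldNormedType.Exports.

Local Open Scope classical_set_scope.
Local Open Scope ring_scope.

Definition countably_generated (d : measure_display) (X : measurableType d) :=
  exists G : set (set X), countable G /\ @measurable d X = <<s G >>.

Section markov_chain.
Context (d d' : measure_display) (R : realType).
Context (X : measurableType d) (Omega : measurableType d').
Implicit Types (P : R.-pker X ~> X) (pi : probability X R).
Implicit Types (Pr : X -> probability Omega R) (Phi : nat -> {mfun Omega >-> X}).

(* The sigma-field generated by Phi_0, ..., Phi_n. *)
Definition history Phi (n : nat) : set (set Omega) :=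
  <<s \bigcup_(i in [set i | (i <= n)%N])
        preimage_set_system [set: Omega] (Phi i) measurable >>.

(* Pr x is the law of the chain started at x. The initial condition is stated
   in law because singletons of X need not be measurable. The Markov property
   Pr_x(Phi_(n+1) \in B | Phi_0, ..., Phi_n) = P(Phi_n, B) is stated in
   integrated form. *)
Record is_markov_chain P Pr Phi : Prop := {
  chain_start : forall x B, measurable B ->
    Pr x (Phi 0%N @^-1` B) = \d_x B ;
  chain_markov : forall x n H B, history Phi n H -> measurable B ->
    Pr x (H `&` Phi n.+1 @^-1` B) = (\int[Pr x]_(w in H) P (Phi n w) B)%E }.

Definition nstep Pr Phi (n : nat) (x : X) : probability X R :=
  distribution (Pr x) (Phi n).

Definition invariant_measure P pi := forall B, measurable B ->
  (\int[pi]_x P x B)%E = pi B.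

(* Equality of the measures pi(dx) P(x, dy) and pi(dy) P(y, dx) on X * X. *)
Definition reversible P pi := forall C : set (X * X), measurable C ->
  (\int[pi]_x P x (xsection C x) = \int[pi]_y P y (ysection C y))%E.

(* For f in L^2(pi), the integral Pf(x) is defined for pi-almost every x. *)
Definition nonneg_definite P pi := forall f : X -> R, f \in Lfun pi 2%:E ->
  (0 <= \int[pi]_x ((f x)%:E * \int[P x]_y (f y)%:E))%E.

Definition irreducible pi Pr Phi := forall B, measurable B -> (0 < pi B)%E ->
  forall x, exists2 n, (0 < n)%N & (0 < nstep Pr Phi n x B)%E.

Definition hitting_time Phi (A : set X) (w : Omega) : \bar R :=
  ereal_inf [set (n%:R)%:E | n in [set n | (0 < n)%N /\ A (Phi n w)]].

(* kappa ^ t for kappa > 1, with kappa ^ (+oo) = +oo. *)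
Definition ext_pow (kappa : R) (t : \bar R) : \bar R :=
  match t with
  | r%:E => (kappa `^ r)%:E
  | +oo%E => +oo%E
  | -oo%E => 0%E
  end.

Definition sup_hitting_moment Pr Phi (A : set X) (kappa : R) : \bar R :=
  ereal_sup
    [set (\int[Pr x]_w ext_pow kappa (hitting_time Phi A w))%E | x in A].

End markov_chain.

(* The norm sup_(|f| <= 1) |(mu - nu)(f)|, not halved. *)
Definition var_dist (d : measure_display) (R : realType) (X : measurableType d)
    (mu nu : probability X R) : \bar R :=
  ereal_sup [set `| \int[mu]_x (f x)%:E - \int[nu]_x (f x)%:E |%E | f in
    [set f : X -> R | measurable_fun [set: X] f /\ forall x, `|f x| <= 1]].

Definition rate_exponent (R : realType) (kappa delta L : R) : R :=
  ln ((L - delta * kappa) / (1 - delta)) / ln kappa.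

(* The minorization forces delta <= 1. When delta = 1 the quotient in
   rate_exponent is meaningless; the rate is then kappa, the limit of the
   formula as delta tends to 1 (for fixed L >= kappa). *)
Definition rate (R : realType) (kappa delta L : R) : R :=
  if delta == 1 then kappa
  else Num.min kappa ((1 - delta) `^ (- (1 / rate_exponent kappa delta L))).

(* Main.v *)
Require Import Defs.
From HB Require Import structures.
From mathcomp Require Import all_boot all_order all_algebra.
From mathcomp Require Import all_classical all_reals all_analysis.
From mathcomp Require Import measurable_realfun zify ring lra.

Set Implicit Arguments.
Unset Strict Implicit.
Unset Printing Implicit Defensive.

Import Order.TTheory GRing.Theory Num.Theory.
Import numFieldNormedType.Exports.

Local Open Scope classical_set_scope.
Local Open Scope ring_scope.

(** Write [Q] for [P] minus its minorizing part [delta 1_A nu]. If [phi_m] is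
    the mean of [K ^ (sigma /\ m)], [sigma] the hitting time of [A] starting
    from time 0, then [K Q phi_m <= phi_(m+1)]: off [A] this is the Markov
    property, and on [A] it is Jensen's inequality applied to the mean of
    [kappa ^ tau], which is what the choice of [K] is made for.

    Contraction in [L^1(pi)]. Let [f] be bounded with [pi f = 0], and let
    [B_i = nu Q^i 1 >= 0] and [g_n = \sum_(i <= n) B_i P^(n-i) f]. Summing the
    renewal equations gives [delta pi(A) (nu g_n) = - pi (Q^(n+1) f)], so that
    [|g_n|] is at most a constant times [(n+1) K^-n phi_n]. As [P] is non-negative
    definite, the autocovariance [m_n = pi (f P^n f)] is at most [pi (f g_n)],
    hence [O(n K^-n)]; and [m] is log-convex, which removes both the factor [n]
    and the constant: [m_n <= m_0 K^-n]. Therefore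
    [(pi |P^n f|)^2 <= m_(2n) <= m_0 K^-(2n)].

    Pointwise bound. Reversibility provides a symmetric density [p] of [P] with
    respect to [pi]. Truncate it at a level above [1 / pi(A)], so that the
    truncated part still carries the minorization, and let [V_0 = 1] and
    [V_(n+1) = 1 + K E V_n], where [E] is the kernel of what exceeds the level.
    The truncated part maps [L^1(pi)] to bounded functions, so [|P^n f|] is at
    most a constant times [K^-n V_n]. Finally [K E phi_j + k <= phi_(j+1)],
    where [k >= 0] vanishes only where [E] does; integrated against [V_m], the
    symmetry of [E] makes the terms telescope and bounds [pi (V_m k)]
    independently of [m], whence [V_m] is bounded in [m] almost everywhere. *)

(** * Integration against mixtures and densities *)

Section mixture.
Local Open Scope ereal_scope.
Context (d d' : measure_display) (R : realType) (T : measurableType d)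
  (Y : measurableType d') (mu : {measure set T -> \bar R})
  (k : T -> {measure set Y -> \bar R}) (m : {measure set Y -> \bar R})
  (D : set T) (mD : measurable D)
  (mk : forall B, measurable B -> measurable_fun [set: T] (k ^~ B))
  (mE : forall B, measurable B -> m B = \int[mu]_(t in D) k t B).

Import HBNNSimple.

Lemma integral_mixture_nnsfun (f : {nnsfun Y >-> R}) :
  \int[m]_y (f y)%:E = \int[mu]_(t in D) \int[k t]_y (f y)%:E.
Proof.
under [RHS]eq_integral do rewrite integralT_nnsfun sintegralE.
rewrite integralT_nnsfun sintegralE.
have mkf r : measurable_fun D (fun t => k t (f @^-1` [set r])).
  by apply: measurable_funTS; exact: mk.
rewrite ge0_integral_fsum//; last 2 first.
- by move=> r; exact: measurable_funeM.
- move=> r t _; have [r0|r0] := leP 0%R r; first by rewrite mule_ge0 ?lee_fin.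
  by rewrite preimage_nnfun0// measure0 mule0.
apply: eq_fsbigr => r _.
have [r0|r0] := leP 0%R r.
  by rewrite ge0_integralZl// mE.
rewrite preimage_nnfun0// measure0 mule0 integral0_eq// => t _.
by rewrite measure0 mule0.
Qed.

(** Monotone convergence along [nnsfun_approx], used for [m] and for every [k t]. Invariance,
    reversibility, the Markov property and densities all enter the proof as mixtures of this
    kind. *)
Lemma integral_mixture (f : Y -> \bar R) : (forall y, 0 <= f y) ->
  measurable_fun [set: Y] f ->
  \int[m]_y f y = \int[mu]_(t in D) \int[k t]_y f y.
Proof.
move=> f0 mf; pose g := nnsfun_approx measurableT mf.
have fE (n : {measure set Y -> \bar R}) :
    \int[n]_y f y = limn (fun i => \int[n]_y (g i y)%:E).
  rewrite -monotone_convergence//; last 3 first.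
  - by move=> i; exact/measurable_EFinP.
  - by move=> i y _; rewrite lee_fin.
  - by move=> y _ a b ab; rewrite lee_fin; exact/lefP/nd_nnsfun_approx.
  by apply: eq_integral => y _; apply/esym/cvg_lim => //; exact: cvg_nnsfun_approx.
rewrite fE; under [in RHS]eq_integral do rewrite fE.
under eq_fun do rewrite integral_mixture_nnsfun.
rewrite -monotone_convergence//.
- move=> i; apply: measurable_funTS; apply: measurable_fun_integral_kernel => //.
  + by move=> y; rewrite lee_fin.
  + exact/measurable_EFinP.
- by move=> i t _; apply: integral_ge0 => y _; rewrite lee_fin.
- move=> t _ a b ab; apply: ge0_le_integral => //.
  + by move=> y _; rewrite lee_fin.
  + exact/measurable_EFinP.
  + exact/measurable_EFinP.
  + by move=> y _; rewrite lee_fin; exact/lefP/nd_nnsfun_approx.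
Qed.

End mixture.


Section integral_compare.
Local Open Scope ereal_scope.
Context (d : measure_display) (R : realType) (T : measurableType d).

Import HBNNSimple.

(** The integral is the supremum over simple functions below [f], and for these the domination is
    applied level set by level set. Dividing by [c] sets the case [c = 0] apart. *)
Lemma ge0_le_integral_measure (m1 m2 : {measure set T -> \bar R}) (c : R)
    (f : T -> \bar R) : (0 <= c)%R ->
  (forall B, measurable B -> c%:E * m1 B <= m2 B) ->
  (forall x, 0 <= f x) -> measurable_fun [set: T] f ->
  c%:E * \int[m1]_x f x <= \int[m2]_x f x.
Proof.
rewrite le_eqVlt => /predU1P[<- _ f0 _|c0 m12 f0 mf].
  by rewrite mul0e integral_ge0.
rewrite -lee_pdivlMl// [leLHS]ge0_integralTE//.
apply: ge_ereal_sup => _ /= [h hf <-].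
rewrite lee_pdivlMl//.
apply: (@le_trans _ _ (sintegral m2 h)); last first.
  rewrite ge0_integralTE//; apply: ereal_sup_ubound; by exists h.
rewrite !sintegralE ge0_mule_fsumr; last first.
  by move=> r; exact: nnsfun_mulemu_ge0.
apply: lee_fsum => // r [t _ <-].
rewrite muleCA; apply: lee_wpmul2l; first by rewrite lee_fin.
exact: m12.
Qed.

(** A measure with density [p] is the mixture over [mu] of the scaled Dirac masses at [t] of weight
    [p t]. *)
Lemma integral_density (mu m : {measure set T -> \bar R}) (p : T -> R)
    (f : T -> \bar R) : (forall x, 0 <= p x)%R -> measurable_fun [set: T] p ->
  (forall B, measurable B -> m B = \int[mu]_(x in B) (p x)%:E) ->
  (forall x, 0 <= f x) -> measurable_fun [set: T] f ->
  \int[m]_x f x = \int[mu]_x ((p x)%:E * f x).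
Proof.
move=> p0 mp mE f0 mf.
pose k t : {measure set T -> \bar R} := mscale (NngNum (p0 t)) (dirac t).
have kE t B : k t B = (p t)%:E * (\1_B t)%:E.
  by rewrite /k /= /mscale/= diracE indicE.
rewrite (@integral_mixture _ _ _ _ _ mu k _ setT)//; last 2 first.
- move=> B mB; rewrite [X in measurable_fun _ X](_ : _ =
    fun t => (p t)%:E * (\1_B t)%:E); last by apply/funext => t; rewrite kE.
  by apply/measurable_EFinP => /=; apply: measurable_funM.
- move=> B mB; rewrite mE// integral_mkcond; apply: eq_integral => t _.
  by rewrite kE patchE indicE; case: ifP => _; rewrite ?mule1 ?mule0.
apply: eq_integral => t _.
rewrite ge0_integral_mscale//.
by rewrite integral_dirac// diracT mul1e.
Qed.

End integral_compare.

(** * Bounded measurable functions and the operator of a kernel *)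

Section bounded_measurable.
Context (d : measure_display) (R : realType) (X : measurableType d).
Implicit Types f g : X -> R.

(** On this class real-valued integrals against probability measures are finite and linear, so no
    integrability condition has to be carried along. *)
Definition bmf f := measurable_fun [set: X] f /\ exists M, forall x, `|f x| <= M.

Lemma bmf_meas f : bmf f -> measurable_fun [set: X] f.
Proof. by case. Qed.

Lemma bmf_cst c : bmf (fun=> c).
Proof. by split; [exact: measurable_cst|exists `|c|]. Qed.

Lemma bmf_indic (A : set X) : measurable A -> bmf (\1_A).
Proof.
move=> mA; split; first exact: measurable_indic.
by exists 1 => x; rewrite indicE; case: (_ \in _); rewrite ?normr1// normr0.
Qed.

Lemma bmfD f g : bmf f -> bmf g -> bmf (fun x => f x + g x).
Proof.
move=> [mf [M hM]] [mg [N hN]]; split; first exact: measurable_funD.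
by exists (M + N) => x; rewrite (le_trans (ler_normD _ _))// lerD.
Qed.

Lemma bmfM f g : bmf f -> bmf g -> bmf (fun x => f x * g x).
Proof.
move=> [mf [M hM]] [mg [N hN]]; split; first exact: measurable_funM.
by exists (M * N) => x; rewrite normrM ler_pM.
Qed.

Lemma bmfZ c f : bmf f -> bmf (fun x => c * f x).
Proof. exact/bmfM/bmf_cst. Qed.

Lemma bmfN f : bmf f -> bmf (fun x => - f x).
Proof.
by move=> /(bmfZ (-1)); under eq_fun do rewrite mulN1r.
Qed.

Lemma bmfB f g : bmf f -> bmf g -> bmf (fun x => f x - g x).
Proof. by move=> bf bg; apply: bmfD => //; exact: bmfN. Qed.

Lemma bmf_abs f : bmf f -> bmf (fun x => `|f x|).
Proof.
move=> [mf [M hM]]; split; first exact: measurableT_comp.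
by exists M => x; rewrite normr_id.
Qed.

Context (m : {measure set X -> \bar R}) (m1 : m [set: X] = 1%E).

Lemma bmf_integrable f : bmf f -> m.-integrable [set: X] (EFin \o f).
Proof.
move=> [mf [M hM]]; apply: measurable_bounded_integrable => //.
  by rewrite m1 ltry.
by exists M; split; [exact: num_real|] => y My x _ /=; rewrite (le_trans (hM x))// ltW.
Qed.

Lemma expE f : bmf f -> (\int[m]_x f x)%:E = (\int[m]_x (f x)%:E)%E.
Proof.
move=> bf; rewrite /Rintegral fineK//.
by apply: integrable_fin_num => //; exact: bmf_integrable.
Qed.

Lemma exp_cst c : \int[m]_x (fun=> c) x = c.
Proof. by rewrite Rintegral_cst// m1/= mulr1. Qed.

Lemma expD f g : bmf f -> bmf g ->
  \int[m]_x (f x + g x) = \int[m]_x f x + \int[m]_x g x.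
Proof. by move=> bf bg; rewrite RintegralD//; exact: bmf_integrable. Qed.

Lemma expB f g : bmf f -> bmf g ->
  \int[m]_x (f x - g x) = \int[m]_x f x - \int[m]_x g x.
Proof. by move=> bf bg; rewrite RintegralB//; exact: bmf_integrable. Qed.

Lemma expZ c f : bmf f -> \int[m]_x (c * f x) = c * \int[m]_x f x.
Proof. by move=> bf; rewrite RintegralZl//; exact: bmf_integrable. Qed.

Lemma exp_indic (A : set X) : measurable A -> (\int[m]_x \1_A x)%:E = m A.
Proof.
by move=> mA; rewrite expE ?integral_indic// ?setIT//; exact: bmf_indic.
Qed.

Lemma le_exp f g : bmf f -> bmf g -> (forall x, f x <= g x) ->
  \int[m]_x f x <= \int[m]_x g x.
Proof. by move=> bf bg fg; apply: le_Rintegral => //; exact: bmf_integrable. Qed.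

Lemma le_norm_exp f : bmf f -> `|\int[m]_x f x| <= \int[m]_x `|f x|.
Proof. by move=> bf; apply: le_normr_Rintegral => //; exact: bmf_integrable. Qed.

Lemma exp_norm_le f c : bmf f -> (forall x, `|f x| <= c) -> `|\int[m]_x f x| <= c.
Proof.
move=> bf fc; rewrite (le_trans (le_norm_exp bf))// -[leRHS]exp_cst.
by apply: le_exp => //; [exact: bmf_abs|exact: bmf_cst].
Qed.

(** Nonnegativity of the variance: the square of [f - c] is expanded around the mean [c]. *)
Lemma sqr_exp_le f : bmf f -> (\int[m]_x f x) ^+ 2 <= \int[m]_x (f x * f x).
Proof.
move=> bf; set c := \int[m]_x f x.
have : 0 <= \int[m]_x ((f x * f x + (- (c *+ 2)) * f x) + c * c).
  by apply: Rintegral_ge0 => x _; have := sqr_ge0 (f x - c); rewrite sqrrB; nra.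
have bff := bmfM bf bf.
have bf2 := bmfZ (- (c *+ 2)) bf.
rewrite expD//; [|exact: bmfD|exact: bmf_cst].
rewrite expD// expZ// exp_cst -/c; nra.
Qed.

End bounded_measurable.

#[global] Hint Resolve bmf_cst bmfD bmfM bmfZ bmfN bmfB bmf_abs : bmf.

Lemma le_exp_measure (d : measure_display) (R : realType) (X : measurableType d)
    (m1 m2 : {measure set X -> \bar R}) (c : R) (f : X -> R) :
  m1 [set: X] = 1%E -> m2 [set: X] = 1%E -> 0 <= c ->
  (forall B, measurable B -> (c%:E * m1 B <= m2 B)%E) ->
  bmf f -> (forall x, 0 <= f x) -> c * \int[m1]_x f x <= \int[m2]_x f x.
Proof.
move=> m11 m21 c0 m12 bf f0; rewrite -lee_fin EFinM !expE//.
apply: ge0_le_integral_measure => //.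
exact/measurable_EFinP/bmf_meas.
Qed.

Section kernel_operator.
Context (d : measure_display) (R : realType) (X : measurableType d)
  (P : R.-pker X ~> X).
Implicit Types f g : X -> R.

Definition kop f (x : X) : R := \int[P x]_y f y.

Lemma kernel_setT x : P x [set: X] = 1%E.
Proof. exact: prob_kernel. Qed.

Lemma bmf_kop f : bmf f -> bmf (kop f).
Proof.
move=> bf; have [mf [M hM]] := bf; split; last first.
  by exists M => x; apply: exp_norm_le => //; exact: kernel_setT.
(* Adding the bound [M] makes the integrand nonnegative, as the measurability of kernel integrals
   requires. *)
have -> : kop f = fun x => fine (\int[P x]_y (f y + M)%:E)%E - M.
  apply/funext => x; rewrite -/(Rintegral _ _ _) expD//; first last.
  - exact: bmf_cst.
  - exact: kernel_setT.
  by rewrite exp_cst ?kernel_setT// addrK.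
apply: measurable_funB => //.
apply: measurableT_comp; first exact: fine_measurable.
apply: measurable_fun_integral_kernel.
- by move=> U mU; exact: measurable_kernel.
- move=> y; rewrite lee_fin; have := hM y; rewrite ler_norml => /andP[]; lra.
- by apply/measurable_EFinP; apply: measurable_funD.
Qed.

Lemma bmf_iter_kop n f : bmf f -> bmf (iter n kop f).
Proof. by move=> bf; elim: n => //= n; exact: bmf_kop. Qed.

Lemma kopD f g : bmf f -> bmf g ->
  kop (fun x => f x + g x) = fun x => kop f x + kop g x.
Proof. by move=> bf bg; apply/funext => x; apply: expD => //; exact: kernel_setT. Qed.

Lemma kopB f g : bmf f -> bmf g ->
  kop (fun x => f x - g x) = fun x => kop f x - kop g x.
Proof. by move=> bf bg; apply/funext => x; apply: expB => //; exact: kernel_setT. Qed.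

Lemma kopZ c f : bmf f -> kop (fun x => c * f x) = fun x => c * kop f x.
Proof. by move=> bf; apply/funext => x; apply: expZ => //; exact: kernel_setT. Qed.

Lemma kop_cst c : kop (fun=> c) = fun=> c.
Proof. by apply/funext => x; apply: exp_cst => //; exact: kernel_setT. Qed.

Lemma le_kop f g x : bmf f -> bmf g -> (forall y, f y <= g y) -> kop f x <= kop g x.
Proof. by move=> *; apply: le_exp => //; exact: kernel_setT. Qed.

End kernel_operator.
#[global] Hint Resolve bmf_kop bmf_iter_kop : bmf.

(** * The contraction in the mean *)

(** Log-convexity makes the ratios [a n.+1 / a n] nondecreasing. A single ratio [q > r] would force
    growth at least like [q ^ j], and [(q / r) ^ j] outgrows every linear bound. *)
Lemma log_convex_geometric_bound (R : realType) (a : nat -> R) (r C : R) :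
  0 < r -> (forall n, 0 <= a n) -> (forall n, a n.+1 ^+ 2 <= a n * a n.+2) ->
  (forall n, a n <= C * n.+1%:R * r ^+ n) -> forall n, a n <= a 0%N * r ^+ n.
Proof.
move=> r0 a0 alc aC.
suff step n : a n.+1 <= r * a n.
  elim=> [|n IHn]; first by rewrite mulr1.
  by rewrite (le_trans (step n))// exprS mulrCA ler_wpM2l// ltW.
rewrite leNgt; apply/negP => rlt.
have an0 : 0 < a n.
  rewrite lt_neqAle a0 andbT eq_sym; apply/eqP => an0.
  have := alc n; rewrite an0 mul0r leNgt exprn_gt0//.
  by move: rlt; rewrite an0 mulr0.
pose q := a n.+1 / a n.
have qr : r < q by rewrite ltr_pdivlMr.
have q0 : 0 < q by rewrite (lt_trans r0).
have ratio j : q * a (n + j)%N <= a (n + j).+1.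
  elim: j => [|j IHj]; first by rewrite addn0 mulfVK ?gt_eqF.
  rewrite addnS; have [->|] := eqVneq (a (n + j).+1) 0; first by rewrite mulr0 a0.
  move=> anz; have anp : 0 < a (n + j).+1 by rewrite lt_neqAle eq_sym anz a0.
  have := alc (n + j)%N; rewrite expr2 => h.
  rewrite -(ler_pM2l anp).
  have h1 := ler_wpM2r (a0 (n + j).+2) IHj.
  have h2 := ler_wpM2l (ltW q0) h; lra.
have grow j : q ^+ j * a n <= a (n + j)%N.
  elim: j => [|j IHj]; first by rewrite mul1r addn0.
  by rewrite addnS (le_trans _ (ratio j))// exprS -mulrA ler_wpM2l// ltW.
pose e := q / r - 1.
have e0 : 0 < e by rewrite subr_gt0 ltr_pdivlMr// mul1r.
have bern j : 1 + j%:R * e <= (q / r) ^+ j.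
  elim: j => [|j IHj]; first by rewrite mul0r addr0.
  have -> : q / r = 1 + e by rewrite /e addrC subrK.
  rewrite exprS -[in leLHS]natr1.
  have : 0 <= e * (j%:R * e) by rewrite !mulr_ge0// ltW.
  have : (1 + e) * (1 + j%:R * e) <= (1 + e) * (1 + e) ^+ j.
    rewrite ler_wpM2l//; first by rewrite addr_ge0// ltW.
    by move: IHj; have -> : q / r = 1 + e by rewrite /e addrC subrK.
  lra.
pose D := C * r ^+ n / a n.
have bound j : (q / r) ^+ j <= D * (n + j).+1%:R.
  rewrite /D expr_div_n ler_pdivrMr ?exprn_gt0// mulrAC -mulrA.
  rewrite mulrAC ler_pdivlMr//.
  rewrite (le_trans (grow j))// (le_trans (aC _))// exprD.
  by rewrite le_eqVlt; apply/orP; left; apply/eqP; ring.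
(* Bernoulli's inequality at exponent [j], squared, is a quadratic lower bound for
   [(q / r) ^ (2 j)], while the upper bound is linear in [j]. *)
have sq j : (1 + j%:R * e) ^+ 2 <= D * (n + j * 2).+1%:R.
  rewrite (le_trans _ (bound _))// exprM.
  rewrite ler_sqr ?nnegrE ?exprn_ge0 ?divr_ge0 ?(ltW q0) ?(ltW r0)//.
  by rewrite addr_ge0// mulr_ge0// ltW.
(* As [n + 2 j + 1 <= (n + 3) j] for [j >= 1], any [j] above this quotient contradicts [sq]. *)
pose B := `|D| * n.+3%:R / e ^+ 2.
have B0 : 0 <= B by rewrite divr_ge0// ?sqr_ge0// mulr_ge0.
pose j := (Num.bound B).+1.
have Bj : B < j%:R by rewrite (lt_le_trans (archi_boundP B0))// ler_nat.
have j1 : (1 : R) <= j%:R by rewrite ler1n.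
move: Bj; rewrite ltr_pdivrMr ?exprn_gt0// => Bj.
have {}Bj : `|D| * n.+3%:R * j%:R < e ^+ 2 * j%:R * j%:R.
  by rewrite ltr_pM2r ?(lt_le_trans ltr01)// [ltRHS]mulrC.
have h1 : D * (n + j * 2).+1%:R <= `|D| * n.+3%:R * j%:R.
  rewrite -mulrA (le_trans (ler_wpM2r _ (ler_norm D)))// ler_wpM2l//.
  by rewrite -natrM ler_nat /j; nia.
have := sq j; have := mulr_ge0 (ler0n R j) (ltW e0).
rewrite expr2 in Bj *; nra.
Qed.

(** The quadratic is evaluated at its minimum [t = - b / c]. For [c = 0] it is affine, and if [b]
    were nonzero it would take the value [-1]. *)
Lemma discriminant_le (R : realFieldType) (a b c : R) :
  (forall t, 0 <= a + 2 * t * b + t ^+ 2 * c) -> 0 <= c -> b ^+ 2 <= a * c.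
Proof.
move=> poly c0; have [cE|cn0] := eqVneq c 0.
  rewrite cE mulr0; have [->|b0] := eqVneq b 0; first by rewrite expr0n.
  have := poly (- (a + 1) / (2 * b)); rewrite cE mulr0 addr0.
  have -> : 2 * (- (a + 1) / (2 * b)) * b = - (a + 1) by field.
  by lra.
have {}c0 : 0 < c by rewrite lt_neqAle eq_sym cn0.
have := poly (- b / c).
have -> : a + 2 * (- b / c) * b + (- b / c) ^+ 2 * c = (a * c - b ^+ 2) / c by field.
by rewrite pmulr_lge0 ?invr_gt0// subr_ge0.
Qed.

Section l2_contraction.
Context (d : measure_display) (R : realType) (X : measurableType d)
  (P : R.-pker X ~> X) (pi nu : probability X R) (A : set X) (delta K : R)
  (phi : nat -> X -> R) (Cpi Cnu pA : R).
Hypothesis mA : measurable A.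
Hypothesis K_gt1 : 1 < K.
Local Notation T := (kop P).
Hypothesis pi_inv : forall f, bmf f -> \int[pi]_x (T f x) = \int[pi]_x f x.
Hypothesis pi_sym : forall f g, bmf f -> bmf g ->
  \int[pi]_x (f x * T g x) = \int[pi]_x (T f x * g x).
Hypothesis pi_psd : forall f, bmf f -> 0 <= \int[pi]_x (f x * T f x).
Hypothesis pA_gt0 : 0 < pA.
Hypothesis pAE : \int[pi]_x \1_A x = pA.
Hypothesis delta_gt0 : 0 < delta.
Hypothesis minor : forall f x, bmf f -> (forall y, 0 <= f y) ->
  delta * \1_A x * \int[nu]_y f y <= T f x.

Definition residual (f : X -> R) (x : X) : R :=
  T f x - delta * \1_A x * \int[nu]_y f y.
Local Notation Q := residual.

Hypothesis bmf_phi : forall n, bmf (phi n).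
Hypothesis phi0 : phi 0%N = fun=> 1.
Hypothesis phi_ge1 : forall n x, 1 <= phi n x.
Hypothesis phi_drift : forall n x, K * Q (phi n) x <= phi n.+1 x.
Hypothesis phi_pi : forall n, \int[pi]_x phi n x <= Cpi.
Hypothesis phi_nu : forall n, \int[nu]_x phi n x <= Cnu.

Let pi1 : pi [set: X] = 1%E. Proof. exact: probability_setT. Qed.
Let nu1 : nu [set: X] = 1%E. Proof. exact: probability_setT. Qed.
Let K0 : 0 < K. Proof. exact: lt_trans ltr01 K_gt1. Qed.
Let delta_ge0 : 0 <= delta. Proof. exact: ltW. Qed.
Let b1A : bmf (\1_A : X -> R). Proof. exact: bmf_indic. Qed.

Lemma bmf_residual f : bmf f -> bmf (Q f).
Proof.
move=> bf; apply: bmfB; first exact: bmf_kop.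
rewrite (_ : (fun _ => _) = fun x => (delta * \int[nu]_y f y) * \1_A x).
  exact: bmfZ.
by apply/funext => x; rewrite mulrAC.
Qed.

Lemma bmf_iter_residual n f : bmf f -> bmf (iter n Q f).
Proof. by move=> bf; elim: n => //= n; exact: bmf_residual. Qed.

Hint Resolve bmf_residual bmf_iter_residual : bmf.

Lemma residual_ge0 f x : bmf f -> (forall y, 0 <= f y) -> 0 <= Q f x.
Proof. by move=> bf f0; rewrite subr_ge0 minor. Qed.

Lemma residualB f g : bmf f -> bmf g ->
  Q (fun x => f x - g x) = fun x => Q f x - Q g x.
Proof.
by move=> bf bg; apply/funext => x; rewrite /Q kopB// expB//; ring.
Qed.

Lemma residualD f g : bmf f -> bmf g ->
  Q (fun x => f x + g x) = fun x => Q f x + Q g x.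
Proof.
by move=> bf bg; apply/funext => x; rewrite /Q kopD// expD//; ring.
Qed.

Lemma residualZ c f : bmf f -> Q (fun x => c * f x) = fun x => c * Q f x.
Proof.
by move=> bf; apply/funext => x; rewrite /Q kopZ// expZ//; ring.
Qed.

Lemma le_residual f g x : bmf f -> bmf g -> (forall y, f y <= g y) ->
  Q f x <= Q g x.
Proof.
move=> bf bg fg; rewrite -subr_ge0.
have := @residual_ge0 (fun x => g x - f x) x (bmfB bg bf).
by rewrite residualB//; apply=> y; rewrite subr_ge0.
Qed.

Lemma norm_residual_le f g x : bmf f -> bmf g -> (forall y, `|f y| <= g y) ->
  `|Q f x| <= Q g x.
Proof.
move=> bf bg fg; rewrite ler_norml; apply/andP; split; last first.
  by apply: le_residual => // y; rewrite (le_trans (ler_norm _)).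
have -> : - Q g x = Q (fun y => -1 * g y) x by rewrite residualZ// mulN1r.
apply: le_residual => //; first exact: bmfZ.
by move=> y; have := fg y; rewrite mulN1r ler_norml => /andP[].
Qed.

Lemma kopE f x : T f x = Q f x + delta * \1_A x * \int[nu]_y f y.
Proof. by rewrite subrK. Qed.

(** By the drift, each application of [Q] gains a factor [K^-1] and raises the index of [phi] by
    one; [phi 0 = 1] carries the initial bound on [f]. *)
Lemma norm_iter_residual_le n f : bmf f -> (forall x, `|f x| <= 2) ->
  forall x, `|iter n Q f x| <= 2 * K ^- n * phi n x.
Proof.
move=> bf f2; elim: n => [|n IHn] x; first by rewrite phi0 expr0 invr1 !mulr1.
have bp : bmf (fun x => 2 * K ^- n * phi n x) by exact: bmfZ.
rewrite (le_trans (norm_residual_le _ _ bp _))//; first exact: bmf_iter_residual.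
rewrite residualZ// exprS invfM.
have k0 : 0 <= 2 * K ^- n by rewrite mulr_ge0// invr_ge0 exprn_ge0// ltW.
have : Q (phi n) x <= K^-1 * phi n.+1 x by rewrite ler_pdivlMl.
by move=> /(ler_wpM2l k0); lra.
Qed.

(** * Renewal equations for the residual kernel *)

Definition renewal_tail n := \int[nu]_x iter n Q (fun=> 1) x.
Local Notation B := renewal_tail.

Lemma iter_residual1_ge0 n x : 0 <= iter n Q (fun=> 1) x.
Proof.
elim: n x => [|n IHn] x //=; apply: residual_ge0 => //.
exact/bmf_iter_residual/bmf_cst.
Qed.

Lemma renewal_tail_ge0 n : 0 <= B n.
Proof. by apply: Rintegral_ge0 => x _; exact: iter_residual1_ge0. Qed.

Lemma renewal_tail_le n : B n <= Cnu * 2 * K ^- n.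
Proof.
have b1 := bmf_iter_residual n (bmf_cst X (1 : R)).
apply: (@le_trans _ _ (\int[nu]_x (2 * K ^- n * phi n x))).
  apply: le_exp => //; first exact: bmfZ.
  move=> x; rewrite (le_trans (ler_norm _))//.
  apply: norm_iter_residual_le; first exact: bmf_cst.
  by move=> y; rewrite normr1 ler1n.
rewrite expZ// mulrC -mulrA ler_wpM2r// mulr_ge0// invr_ge0 exprn_ge0// ltW//.
Qed.

(** This comes from [Q 1 = 1 - delta 1_A]. With [B n] read as the probability that the split chain
    started from [nu] has not regenerated within [n] steps, the difference is the probability of
    regeneration at step [n.+1]. *)
Lemma renewal_tail_step n :
  B n - B n.+1 = delta * \int[nu]_x iter n Q \1_A x.
Proof.
have E k : iter k.+1 Q (fun=> 1) =
    fun x => iter k Q (fun=> 1) x - delta * iter k Q \1_A x.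
  elim: k => [|k IHk].
    by apply/funext => x; rewrite /= /Q kop_cst exp_cst// mulr1.
  by rewrite [LHS]iterS [in LHS]IHk residualB ?residualZ//; auto with bmf.
rewrite {2}/B E expB; [|exact: nu1| |]; auto with bmf.
by rewrite expZ; auto with bmf; rewrite opprB addrC subrK.
Qed.

Context (f : X -> R).
Hypothesis bf : bmf f.
Hypothesis f2 : forall x, `|f x| <= 2.
Hypothesis f_mean0 : \int[pi]_x f x = 0.

Local Notation c j := (\int[nu]_x iter j T f x).

(** The outermost [T] is split as [Q + delta 1_A nu]; the rank-one part contributes
    [delta nu Q^j 1_A], an increment of [B]. The power [j] collects the factors [Q] already split
    off, and [j = 0] gives the renewal equation for [c n]. *)
Lemma iter_kop_residual n j : \int[nu]_x iter j Q (iter n T f) x =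
  \int[nu]_x iter (j + n) Q f x
  + \sum_(i < n) (B (j + i) - B (j + i).+1) * c (n.-1 - i)%N.
Proof.
elim: n j => [|n IHn] j; first by rewrite addn0 big_ord0 addr0.
have -> : iter j Q (iter n.+1 T f) =
    fun x => iter j.+1 Q (iter n T f) x + c n * delta * iter j Q \1_A x.
  have -> : iter n.+1 T f = fun x => Q (iter n T f) x + c n * delta * \1_A x.
    by apply/funext => x; rewrite /= kopE; ring.
  elim: j => [//|j IHj].
  by rewrite [LHS]iterS IHj residualD ?residualZ//; auto with bmf.
rewrite expD; [|exact: nu1| |]; auto with bmf.
rewrite IHn addSnnS -addrA; congr (_ + _).
rewrite big_ord_recl addn0 subn0 /= addrC; congr (_ + _).
  rewrite expZ; auto with bmf.
  by rewrite renewal_tail_step; ring.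
apply: eq_bigr => i _; rewrite /bump /= add1n addSnnS.
by have -> : (n.-1 - i = n - i.+1)%N by lia.
Qed.

(* [g n] is the sum over [i <= n] of [B i *: T^(n - i) f]. *)
Fixpoint renewal_sum n : X -> R :=
  if n is m.+1 then fun x => T (renewal_sum m) x + B m.+1 * f x else f.
Local Notation g := renewal_sum.

Lemma bmf_renewal_sum n : bmf (g n).
Proof. by elim: n => //= n IHn; apply: bmfD; [exact: bmf_kop|exact: bmfZ]. Qed.

Lemma nu_iter_renewal_sum j n : \int[nu]_x iter j T (g n) x =
  \sum_(i < n.+1) B i * c (n - i + j)%N.
Proof.
elim: n j => [|n IHn] j.
  by rewrite big_ord1 subn0 add0n /B /= exp_cst// mul1r.
have -> : iter j T (g n.+1) = fun x => iter j.+1 T (g n) x + B n.+1 * iter j T f x.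
  elim: j => [//|j IHj].
  rewrite [LHS]iterS IHj kopD ?kopZ//; auto with bmf.
  by apply: bmf_iter_kop; exact: bmf_renewal_sum.
rewrite expD; [|exact: nu1| |]; auto with bmf; last first.
  by apply: bmf_iter_kop; exact: bmf_renewal_sum.
rewrite IHn expZ; auto with bmf.
rewrite [RHS]big_ord_recr/= subnn add0n; congr (_ + _).
apply: eq_bigr => i _.
by have -> : (n - i + j.+1 = n.+1 - i + j)%N by have := ltn_ord i; lia.
Qed.

(** In the renewal equation for [c n.+1] the weights are [B i - B i.+1]: the negative parts cancel
    the terms of [nu (g n.+1)] other than the first, and the positive parts make up [nu (g n)]. *)
Lemma nu_renewal_sum_step n :
  \int[nu]_x g n.+1 x = \int[nu]_x g n x + \int[nu]_x iter n.+1 Q f x.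
Proof.
rewrite -[g n.+1]/(iter 0 T (g n.+1)) -[g n]/(iter 0 T (g n)).
rewrite !nu_iter_renewal_sum.
have := iter_kop_residual n.+1 0; rewrite add0n /= => cE.
rewrite big_ord_recl /= ?subn0 ?addn0 {1}/B /= exp_cst// mul1r cE.
rewrite -addrA addrC; congr (_ + _).
rewrite -big_split /=; apply: eq_bigr => i _.
by rewrite /bump/= add1n subSS !addn0 add0n; ring.
Qed.

Lemma pi_residual h : bmf h ->
  \int[pi]_x Q h x = \int[pi]_x h x - delta * pA * \int[nu]_x h x.
Proof.
move=> bh; have -> : Q h = fun x => T h x - delta * \int[nu]_y h y * \1_A x.
  by apply/funext => x; rewrite /Q; ring.
rewrite expB; [|exact: pi1| |]; auto with bmf.
by rewrite pi_inv// expZ// pAE; ring.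
Qed.

(** Both sides change by [delta pA nu (Q^(n+1) f)] from [n] to [n.+1], and they agree at [n = 0]
    because [pi f = 0]. *)
Lemma nu_renewal_sumE n :
  delta * pA * \int[nu]_x g n x = - \int[pi]_x iter n.+1 Q f x.
Proof.
elim: n => [|n IHn]; first by rewrite /= pi_residual// f_mean0 sub0r opprK.
rewrite nu_renewal_sum_step mulrDr IHn [in RHS]iterS pi_residual; auto with bmf.
ring.
Qed.

Lemma norm_nu_renewal_sum_le n :
  delta * `|\int[nu]_x g n x| <= 2 * Cpi / pA * K ^- n.+1.
Proof.
have : pA * (delta * `|\int[nu]_x g n x|) <= 2 * K ^- n.+1 * Cpi.
  rewrite mulrA -{1}(gtr0_norm pA_gt0) -{1}(gtr0_norm delta_gt0).
  rewrite -!normrM [pA * _]mulrC nu_renewal_sumE normrN.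
  rewrite (le_trans (le_norm_exp _ _))//; first by auto with bmf.
  have k0 : 0 <= 2 * K ^- n.+1 by rewrite mulr_ge0// invr_ge0 exprn_ge0// ltW.
  apply: (@le_trans _ _ (\int[pi]_x (2 * K ^- n.+1 * phi n.+1 x))).
    apply: le_exp => //; auto with bmf.
    by move=> x; exact: norm_iter_residual_le.
  by rewrite expZ// ler_wpM2l.
rewrite -ler_pdivlMl// => /le_trans; apply.
by rewrite le_eqVlt; apply/orP; left; apply/eqP; ring.
Qed.

Lemma Cpi_ge0 : 0 <= Cpi.
Proof.
by rewrite (le_trans _ (phi_pi 0))// phi0 exp_cst.
Qed.

Lemma Cnu_ge0 : 0 <= Cnu.
Proof.
by rewrite (le_trans _ (phi_nu 0))// phi0 exp_cst.
Qed.

(** The three terms account for [f] itself, for the regeneration term [delta 1_A nu (g n)] and for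
    the new term [B n.+1 f]. *)
Let G := 2 + 2 * Cpi / pA + 4 * Cnu.

(** In [g n.+1 = Q (g n) + delta 1_A nu (g n) + B n.+1 f], the drift carries the previous bound
    through [Q] with one more factor [K^-1]. The other two terms are each [O(K^-(n+1))], so a step
    adds one to the linear factor. *)
Lemma norm_renewal_sum_le n x :
  `|g n x| <= G * n.+1%:R * K ^- n * phi n x.
Proof.
have cA0 : 0 <= 2 * Cpi / pA by rewrite divr_ge0 ?(ltW pA_gt0)// mulr_ge0// Cpi_ge0.
have G0 : 0 <= G by rewrite /G; have := Cnu_ge0; lra.
elim: n x => [|n IHn] x.
  rewrite phi0 /= expr0 invr1 !mulr1 (le_trans (f2 x))// /G.
  by have := Cnu_ge0; lra.
have kn0 : 0 <= K ^- n by rewrite invr_ge0 exprn_ge0// ltW.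
have kn10 : 0 <= K ^- n.+1 by rewrite invr_ge0 exprn_ge0// ltW.
have bp : bmf (fun x => G * n.+1%:R * K ^- n * phi n x) by exact: bmfZ.
have -> : g n.+1 x = Q (g n) x + delta * \1_A x * (\int[nu]_y g n y) + B n.+1 * f x.
  by rewrite /= kopE.
have h1 : `|Q (g n) x| <= G * n.+1%:R * K ^- n.+1 * phi n.+1 x.
  rewrite (le_trans (norm_residual_le _ _ bp _))//; first exact: bmf_renewal_sum.
  rewrite residualZ// exprS invfM.
  have k0 : 0 <= G * n.+1%:R * K ^- n by rewrite !mulr_ge0.
  have : Q (phi n) x <= K^-1 * phi n.+1 x by rewrite ler_pdivlMl.
  by move=> /(ler_wpM2l k0); lra.
have h2 : `|delta * \1_A x * (\int[nu]_y g n y)| <= 2 * Cpi / pA * K ^- n.+1 * phi n.+1 x.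
  rewrite !normrM (gtr0_norm delta_gt0).
  have i1 : `|\1_A x : R| <= 1 by rewrite indicE; case: (_ \in _); rewrite ?normr1// normr0.
  have := norm_nu_renewal_sum_le n.
  have n0 : 0 <= delta * `|\int[nu]_x g n x| by rewrite mulr_ge0.
  move=> h; rewrite [leLHS]mulrAC.
  apply: (@le_trans _ _ (2 * Cpi / pA * K ^- n.+1 * 1)); last first.
    by rewrite ler_wpM2l// mulr_ge0.
  by rewrite mulr1 (le_trans _ h)// ler_piMr.
have h3 : `|B n.+1 * f x| <= 4 * Cnu * K ^- n.+1 * phi n.+1 x.
  rewrite normrM (ger0_norm (renewal_tail_ge0 _)).
  apply: (@le_trans _ _ (Cnu * 2 * K ^- n.+1 * 2)).
    by rewrite ler_pM// ?renewal_tail_ge0// renewal_tail_le.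
  have : 0 <= Cnu * K ^- n.+1 by rewrite mulr_ge0// Cnu_ge0.
  by move=> c0; have := ler_wpM2l c0 (phi_ge1 n.+1 x); lra.
rewrite (le_trans (ler_normD _ _))// (le_trans (lerD (ler_normD _ _) (lexx _)))//.
have p0 : 0 <= K ^- n.+1 * phi n.+1 x.
  by rewrite mulr_ge0// (le_trans ler01).
have : G * n.+2%:R * K ^- n.+1 * phi n.+1 x =
  G * n.+1%:R * K ^- n.+1 * phi n.+1 x + G * (K ^- n.+1 * phi n.+1 x).
  by rewrite -[n.+2%:R]natr1; ring.
move=> ->; have : (2 * Cpi / pA + 4 * Cnu) * (K ^- n.+1 * phi n.+1 x) <=
    G * (K ^- n.+1 * phi n.+1 x).
  by rewrite ler_wpM2r// /G; lra.
lra.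
Qed.

(** * Autocovariances under reversibility and non-negative definiteness *)

Lemma kop_iter_sym n h k : bmf h -> bmf k ->
  \int[pi]_x (h x * iter n T k x) = \int[pi]_x (iter n T h x * k x).
Proof.
move=> bh; elim: n k => [//|n IHn] k bk.
by rewrite iterSr IHn; auto with bmf; rewrite pi_sym; auto with bmf.
Qed.

(** For even [n], symmetry turns the integrand into a square. For odd [n] it leaves one [T] between
    two equal factors, where [pi_psd] applies. *)
Lemma kop_iter_psd n h : bmf h -> 0 <= \int[pi]_x (h x * iter n T h x).
Proof.
move=> bh; have [j [->|->]] : exists j, n = (j + j)%N \/ n = (j + j.+1)%N.
  exists n./2; have := odd_double_half n; rewrite -addnn.
  by case: (odd n) => /=; lia.
- rewrite iterD kop_iter_sym; auto with bmf.
  by apply: Rintegral_ge0 => x _; rewrite -expr2 sqr_ge0.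
- by rewrite iterD kop_iter_sym; auto with bmf; apply: pi_psd; auto with bmf.
Qed.

Let m k := \int[pi]_x (f x * iter k T f x).

(** The form [pi (h T^n h)] is nonnegative at [h = f + t T f] for every [t]; as a quadratic in [t]
    it is built from [m n], [m n.+1] and [m n.+2]. *)
Lemma autocov_log_convex n : m n.+1 ^+ 2 <= m n * m n.+2.
Proof.
apply: discriminant_le => [t|]; last exact: kop_iter_psd.
have bh : bmf (fun x => f x + t * T f x) by auto with bmf.
have := kop_iter_psd n bh.
have -> : iter n T (fun x => f x + t * T f x) =
    fun x => iter n T f x + t * iter n.+1 T f x.
  by elim: n => [//|k IHk]; rewrite [LHS]iterS IHk kopD ?kopZ//; auto with bmf.
congr (0 <= _).
transitivity (\int[pi]_x (f x * iter n T f x + t * (f x * iter n.+1 T f x) +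
   (t * (T f x * iter n T f x) + t ^+ 2 * (T f x * iter n.+1 T f x)))).
  congr (Rintegral _ _ _); apply/funext => x.
  by move: (f x) (T f x) (iter n T f x) (iter n.+1 T f x) => *; ring.
have s k : \int[pi]_x (T f x * iter k T f x) = m k.+1.
  by rewrite -pi_sym; auto with bmf.
rewrite !expD; auto 7 with bmf.
rewrite !expZ; auto 7 with bmf.
rewrite !s -!/(m _).
by move: (m n) (m n.+1) (m n.+2) => *; ring.
Qed.

(** The induction moves one [T] onto the left factor and drops the nonnegative term
    [B n.+1 pi (T^j f f)]. The case [j = 0] compares [m n] with [pi (f g n)]. *)
Lemma autocov_le_renewal n j :
  m (n + j)%N <= \int[pi]_x (iter j T f x * g n x).
Proof.
elim: n j => [|n IHn] j.
  by rewrite add0n /m kop_iter_sym; auto with bmf.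
have bg := bmf_renewal_sum n.
rewrite addSnnS (le_trans (IHn _))//.
have -> : \int[pi]_x (iter j T f x * g n.+1 x) =
    \int[pi]_x (iter j T f x * T (g n) x) + B n.+1 * \int[pi]_x (iter j T f x * f x).
  rewrite -expZ -?expD; auto 7 with bmf.
  by congr (Rintegral _ _ _); apply/funext => x /=; ring.
rewrite pi_sym; auto with bmf; rewrite -iterS lerDl mulr_ge0 ?renewal_tail_ge0//.
by rewrite -kop_iter_sym; auto with bmf; exact: kop_iter_psd.
Qed.

Lemma autocov_le n : m n <= m 0%N * (K^-1) ^+ n.
Proof.
have m0 k : 0 <= m k by exact: kop_iter_psd.
(* The constant collects [|f| <= 2], the factor [G] bounding [g n], and the bound on the mean of
   [phi n]. *)
apply: (@log_convex_geometric_bound _ m K^-1 (2 * G * Cpi)).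
- by rewrite invr_gt0.
- exact: m0.
- exact: autocov_log_convex.
move=> {}n; have := autocov_le_renewal n 0; rewrite addn0 => /le_trans; apply.
rewrite /=.
have bg := bmf_renewal_sum n.
apply: (@le_trans _ _ (\int[pi]_x ((2 * G * n.+1%:R * K ^- n) * phi n x))).
  apply: le_exp; [exact: pi1|auto with bmf|auto with bmf|].
  move=> x; rewrite (le_trans (ler_norm _))// normrM.
  apply: (@le_trans _ _ (2 * (G * n.+1%:R * K ^- n * phi n x))); last by lra.
  by rewrite ler_pM// norm_renewal_sum_le.
rewrite expZ// exprVn.
have G0 : 0 <= G.
  have cA0 : 0 <= 2 * Cpi / pA by rewrite divr_ge0 ?(ltW pA_gt0)// mulr_ge0// Cpi_ge0.
  by rewrite /G; have := Cnu_ge0; lra.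
have k0 : 0 <= 2 * G * n.+1%:R * K ^- n.
  by rewrite !mulr_ge0// invr_ge0 exprn_ge0// ltW.
by have /= := ler_wpM2l k0 (phi_pi n); lra.
Qed.

Lemma norm_iter_kop_mean_le n : \int[pi]_x `|iter n T f x| <= 2 * K ^- n.
Proof.
rewrite -ler_sqr ?nnegrE; first last.
- by rewrite mulr_ge0// invr_ge0 exprn_ge0// ltW.
- by apply: Rintegral_ge0.
rewrite (le_trans (sqr_exp_le _ _))//; first by auto with bmf.
have -> : \int[pi]_x (`|iter n T f x| * `|iter n T f x|) = m (n + n).
  rewrite /m iterD kop_iter_sym; auto with bmf.
  congr (Rintegral _ _ _); apply/funext => x.
  by rewrite -normrM ger0_norm// -expr2 sqr_ge0.
rewrite (le_trans (autocov_le _))// exprMn -exprVn -exprM muln2 -addnn.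
rewrite ler_wpM2r//; first by rewrite exprn_ge0// invr_ge0 ltW.
(* Here [m 0 <= 4], the square of the bound on [f]. *)
rewrite /m/= (le_trans (ler_norm _))// exp_norm_le//; first exact: bmfM.
move=> x; rewrite normrM expr2; exact: ler_pM.
Qed.

End l2_contraction.

(** * Truncated moments of the hitting time *)

(* Tangent line at [u] of the concave function [y ^ s] of [y = expR v / expR u]. *)
Lemma expR_tangent (R : realType) (s u v : R) : 0 <= s <= 1 ->
  expR (s * v) <= (1 - s) * expR (s * u) + s * expR ((s - 1) * u) * expR v.
Proof.
move=> /andP[s0 s1].
have e1 : expR (s * u) = expR (s * v) * expR (s * (u - v)).
  by rewrite -expRD; congr expR; ring.
have e2 : expR ((s - 1) * u) * expR v = expR (s * v) * expR ((1 - s) * (v - u)).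
  by rewrite -!expRD; congr expR; ring.
rewrite -mulrA e2 e1.
have p0 := expR_gt0 (s * v).
have h1 : (1 - s) * (1 + s * (u - v)) <= (1 - s) * expR (s * (u - v)).
  by rewrite ler_wpM2l ?expR_ge1Dx// subr_ge0.
have h2 : s * (1 + (1 - s) * (v - u)) <= s * expR ((1 - s) * (v - u)).
  by rewrite ler_wpM2l ?expR_ge1Dx.
have : 1 <= (1 - s) * expR (s * (u - v)) + s * expR ((1 - s) * (v - u)) by lra.
move=> /(ler_wpM2l (ltW p0)); lra.
Qed.

Section hitting_drift.
Context (d : measure_display) (R : realType) (X : measurableType d)
  (P : R.-pker X ~> X) (A : set X).
Hypothesis mA : measurable A.
Local Notation T := (kop P).

(* The mean of [k ^ (tau /\ m)] from [x], for [tau] the first time [n >= 0] at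
   which the chain is in [A]. *)
Fixpoint hit_moment (k : R) (m : nat) : X -> R :=
  if m is n.+1 then fun x => \1_A x + \1_(~` A) x * (k * T (hit_moment k n) x)
  else fun=> 1.

Let b1A : bmf (\1_A : X -> R). Proof. exact: bmf_indic. Qed.
Let b1Ac : bmf (\1_(~` A) : X -> R).
Proof. by apply: bmf_indic; exact: measurableC. Qed.

Lemma bmf_hit_moment k m : bmf (hit_moment k m).
Proof.
elim: m => [|m IHm] /=; first exact: bmf_cst.
by apply: bmfD => //; apply: bmfM => //; apply: bmfZ; exact: bmf_kop.
Qed.

Lemma hit_moment_in k m x : A x -> hit_moment k m x = 1.
Proof.
by case: m => //= m Ax; rewrite !indicE mem_set// memNset ?mul0r ?addr0//.
Qed.

Lemma hit_moment_out k m x : ~ A x ->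
  hit_moment k m.+1 x = k * T (hit_moment k m) x.
Proof. by move=> Ax; rewrite /= !indicE memNset// mem_set// add0r mul1r. Qed.

Lemma le_hit_moment_step k m : 1 <= k -> forall x,
  hit_moment k m x <= hit_moment k m.+1 x.
Proof.
move=> k1; have k0 : 0 <= k by rewrite (le_trans ler01).
elim: m => [|m IHm] x.
  have [Ax|Ax] := pselect (A x); first by rewrite !hit_moment_in.
  by rewrite hit_moment_out//= kop_cst mulr1.
have [Ax|Ax] := pselect (A x); first by rewrite !hit_moment_in.
rewrite !hit_moment_out// ler_wpM2l//.
by apply: le_kop => //; exact: bmf_hit_moment.
Qed.

Lemma hit_moment_ge1 k m x : 1 <= k -> 1 <= hit_moment k m x.
Proof.
move=> k1; elim: m => [//|m IHm].
exact: (le_trans IHm (le_hit_moment_step _ k1 _)).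
Qed.

(** An inequality between powers passes to means because [T] is positive and fixes constants. As [j]
    counts the steps already taken, [k ^ j * hit_moment k m] is the mean of [k ^ (j + tau /\ m)]. *)
Lemma hit_moment_affine (k l a b : R) m j : 0 <= k -> 0 <= l ->
  (forall n, k ^+ (n + j) <= a + b * l ^+ (n + j)) ->
  forall x, k ^+ j * hit_moment k m x <= a + b * (l ^+ j * hit_moment l m x).
Proof.
move=> k0 l0; elim: m j => [|m IHm] j kl x; first by rewrite !mulr1; exact: (kl 0%N).
have [Ax|Ax] := pselect (A x).
  by rewrite !hit_moment_in// !mulr1; exact: (kl 0%N).
rewrite !hit_moment_out// !(mulrA (_ ^+ _)) -!exprSr.
have bh c := bmf_hit_moment c m.
have -> : a = T (fun=> a) x by rewrite kop_cst.
have h' : forall y, k ^+ j.+1 * hit_moment k m y <=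
    a + b * (l ^+ j.+1 * hit_moment l m y).
  by move=> y; apply: IHm => n; rewrite -addSnnS; exact: kl.
have := @le_kop _ _ _ P (fun y => k ^+ j.+1 * hit_moment k m y)
  (fun y => a + b * (l ^+ j.+1 * hit_moment l m y)) x.
by rewrite kopD ?kopZ//; auto with bmf; apply; auto with bmf.
Qed.

Lemma le_hit_moment_base (k l : R) m x : 0 <= k -> k <= l ->
  hit_moment k m x <= hit_moment l m x.
Proof.
move=> k0 kl; have := @hit_moment_affine k l 0 1 m 0 k0 (le_trans k0 kl).
rewrite !expr0 => /(_ _ x); rewrite !mul1r add0r; apply=> n.
by rewrite add0r mul1r lerXn2r// nnegrE// (le_trans k0).
Qed.

Context (nu : probability X R) (delta kappa L : R).
Hypothesis kappa_gt1 : 1 < kappa.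
Hypothesis delta_gt0 : 0 < delta.
Hypothesis minor : forall f x, bmf f -> (forall y, 0 <= f y) ->
  delta * \1_A x * \int[nu]_y f y <= T f x.
Hypothesis A_nonempty : A !=set0.
Hypothesis hitL : forall m x, A x -> kappa * T (hit_moment kappa m) x <= L.

Local Notation Q := (residual P nu A delta).
Local Notation K := (rate kappa delta L).

Let nu1 : nu [set: X] = 1%E. Proof. exact: probability_setT. Qed.
Let kappa0 : 0 < kappa. Proof. exact: lt_trans ltr01 kappa_gt1. Qed.

Lemma minor_le1 : delta <= 1.
Proof.
have [x Ax] := A_nonempty.
have := @minor (fun=> 1) x (bmf_cst _ _) (fun=> ler01).
by rewrite kop_cst exp_cst// indicE mem_set// !mulr1.
Qed.

Lemma kappa_le_moment : kappa <= L.
Proof.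
by have [x Ax] := A_nonempty; have := hitL 0 Ax; rewrite /= kop_cst mulr1.
Qed.

(** For [delta < 1], a bound on the truncated mean of [kappa ^ tau_A] from a point of [A] when the
    first step follows the normalised residual [Q / (1 - delta)]. The exponent of the rate is
    [ln M / ln kappa]. *)
Let M := (L - delta * kappa) / (1 - delta).

Lemma moment_ratio_gt1 : delta < 1 -> 1 < M.
Proof.
move=> d1; rewrite ltr_pdivlMr ?subr_gt0// mul1r.
have := kappa_le_moment; have : (1 - delta) * 1 < (1 - delta) * kappa.
  by rewrite ltr_pM2l// subr_gt0.
lra.
Qed.

Lemma rate_le : K <= kappa.
Proof. by rewrite /rate; case: ifP => // _; rewrite ge_min lexx. Qed.

Lemma rate_gt1 : 1 < K.
Proof.
rewrite /rate; case: ifPn => // d1; rewrite lt_min kappa_gt1/=.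
have {}d1 : delta < 1 by rewrite lt_neqAle d1 minor_le1.
have d0 : 0 < 1 - delta by rewrite subr_gt0.
rewrite -ltr_ln ?posrE// ?powR_gt0// ln1 ln_powR mulNr -mulrN mulr_gt0//.
  by rewrite mul1r invr_gt0 divr_gt0 ?ln_gt0// moment_ratio_gt1.
by rewrite oppr_gt0 ln_lt0// d0 ltrBlDr ltrDl.
Qed.

(** Write [K = kappa ^ s] with [s] in [[0, 1]]. By concavity of [y ^ s] the left side is at most
    [(1 - delta) M ^ s], and [K <= (1 - delta) ^ (- 1 / alpha)], with [alpha = ln M / ln kappa],
    says exactly that this is at most [1]. *)
Lemma rate_jensen m x : delta < 1 -> A x -> K * Q (hit_moment K m) x <= 1.
Proof.
move=> d1 Ax; have K1 := rate_gt1; have K0 := lt_trans ltr01 K1.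
have d0 : 0 < 1 - delta by rewrite subr_gt0.
have M1 := moment_ratio_gt1 d1; have M0 := lt_trans ltr01 M1.
pose u := ln M; pose q := ln kappa; pose s := ln K / q.
have q0 : 0 < q by exact: ln_gt0.
have sq : s * q = ln K by rewrite /s divfK ?gt_eqF.
have s01 : 0 <= s <= 1.
  apply/andP; split; first by rewrite divr_ge0 ?(ltW q0) ?ln_ge0 ?(ltW K1).
  by rewrite ler_pdivrMr// mul1r ler_ln ?posrE ?rate_le.
have Ms : (1 - delta) * expR (s * u) <= 1.
  rewrite -[X in X * _]lnK ?posrE// -expRD -[leRHS]expR0 ler_expR.
  have u0 : 0 < u by exact: ln_gt0.
  have : ln K <= - (1 / (u / q)) * ln (1 - delta).
    rewrite -ln_powR ler_ln ?posrE// ?powR_gt0// /rate lt_eqF//.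
    by rewrite ge_min lexx orbT.
  rewrite -sq -(ler_pM2r u0) => h.
  have : q * (s * u + ln (1 - delta)) <= q * 0; last by rewrite ler_pM2l// addrC.
  rewrite mulr0.
  have -> : q * (s * u + ln (1 - delta)) =
    s * q * u - - (1 / (u / q)) * ln (1 - delta) * u.
    by field; rewrite !gt_eqF.
  by rewrite subr_le0.
(* Intercept and slope of the tangent to [y ^ s] at [y = M]: Jensen's inequality in the form of a
   supporting line, to which [hit_moment_affine] applies. *)
pose a := (1 - s) * expR (s * u); pose b := s * expR ((s - 1) * u).
have b0 : 0 <= b by rewrite mulr_ge0 ?expR_ge0//; case/andP: s01.
have kE (k : R) n : 0 < k -> k ^+ n = expR (n%:R * ln k).
  by move=> k0; rewrite expRM_natl lnK ?posrE.
have aff y : K ^+ 1 * hit_moment K m y <=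
    a + b * (kappa ^+ 1 * hit_moment kappa m y).
  apply: hit_moment_affine; rewrite ?ltW// => n.
  rewrite !kE// -sq mulrCA; exact: expR_tangent.
rewrite !expr1 in aff.
have bh k := bmf_hit_moment k m.
have -> : K * Q (hit_moment K m) x = Q (fun y => K * hit_moment K m y) x.
  by rewrite residualZ.
apply: (@le_trans _ _ (Q (fun y => a + b * (kappa * hit_moment kappa m y)) x)).
  by apply: le_residual => //; auto with bmf.
rewrite residualD ?residualZ//; auto with bmf.
rewrite /residual kop_cst exp_cst// indicE mem_set// !mulr1.
(* The mean under [nu] is at least [1], so removing the minorizing part lowers the bound [L] to
   [L - delta * kappa]. *)
have nug : 1 <= \int[nu]_y hit_moment kappa m y.
  rewrite -[leLHS](exp_cst nu1 1); apply: le_exp => //; first exact: bmf_cst.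
  by move=> y; apply: hit_moment_ge1; exact: ltW.
have hL := hitL m Ax.
have : b * (kappa * T (hit_moment kappa m) x
   - kappa * delta * \int[nu]_y hit_moment kappa m y) <= b * (L - delta * kappa).
  rewrite ler_wpM2l//.
  have : kappa * delta * 1 <= kappa * delta * \int[nu]_y hit_moment kappa m y.
    by rewrite ler_wpM2l// mulr_ge0// ltW.
  lra.
have bM : b * (L - delta * kappa) = (1 - delta) * (s * expR (s * u)).
  have -> : L - delta * kappa = (1 - delta) * expR u.
    by rewrite lnK ?posrE// /M [RHS]mulrC divfK ?gt_eqF.
  have -> : s * u = (s - 1) * u + u by ring.
  by rewrite expRD /b; ring.
have : a - delta * a = (1 - delta) * ((1 - s) * expR (s * u)) by rewrite /a; ring.
lra.
Qed.

(** For [delta = 1] the residual annihilates constants on [A], so its positivity at [N - f] gives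
    the sign. *)
Lemma residual_delta1 f x : delta = 1 -> bmf f -> A x -> Q f x <= 0.
Proof.
move=> d1 bf Ax; have [_ [N hN]] := bf.
have := residual_ge0 minor (f := fun y => N - f y) x.
rewrite residualB//; auto with bmf.
rewrite {1}/residual kop_cst exp_cst// d1 indicE mem_set// !mul1r subrr sub0r oppr_ge0.
apply; first by auto with bmf.
by move=> y; rewrite subr_ge0 (le_trans (ler_norm _)).
Qed.

Lemma hit_moment_drift m x : K * Q (hit_moment K m) x <= hit_moment K m.+1 x.
Proof.
have K1 := rate_gt1; have K0 := lt_trans ltr01 K1.
have [Ax|Ax] := pselect (A x); last first.
  by rewrite hit_moment_out// /residual indicE memNset// mulr0 mul0r subr0.
rewrite hit_moment_in//; have := minor_le1; rewrite le_eqVlt => /predU1P[d1|d1].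
  rewrite (@le_trans _ _ 0)//.
  by rewrite pmulr_rle0// residual_delta1//; exact: bmf_hit_moment.
exact: rate_jensen.
Qed.

Lemma kop_hit_moment_le m x : A x -> K * T (hit_moment K m) x <= L.
Proof.
move=> Ax; have K1 := rate_gt1; have K0 := lt_trans ltr01 K1.
rewrite (le_trans _ (hitL m Ax))//; apply: ler_pM; [exact: ltW| |exact: rate_le|].
  by apply: Rintegral_ge0 => y _; rewrite (le_trans ler01)// hit_moment_ge1// ltW.
apply: le_kop; [exact: bmf_hit_moment|exact: bmf_hit_moment|] => y.
by apply: le_hit_moment_base; [exact: ltW|exact: rate_le].
Qed.

(** At any point of [A] the minorization gives [delta nu phi <= T phi], and [T phi <= L / K]
    there. *)
Lemma nu_hit_moment_le m : \int[nu]_x hit_moment K m x <= L / (delta * K).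
Proof.
have K1 := rate_gt1; have K0 := lt_trans ltr01 K1.
have [x Ax] := A_nonempty; rewrite ler_pdivlMr ?mulr_gt0//.
rewrite (le_trans _ (kop_hit_moment_le m Ax))// mulrA [leRHS]mulrC ler_pM2r//.
have := @minor (hit_moment K m) x (bmf_hit_moment _ _).
rewrite indicE mem_set// mulr1 mulrC; apply=> y.
by rewrite (le_trans ler01)// hit_moment_ge1// ltW.
Qed.

End hitting_drift.

(** * Invariance and reversibility as operator identities *)

Section joint_law.
Context (d : measure_display) (R : realType) (X : measurableType d)
  (P : R.-pker X ~> X) (pi : probability X R).
Local Open Scope ereal_scope.

(** The law of two consecutive states in stationarity. As a measure on the product it can be
    disintegrated along either coordinate and has a Radon-Nikodym density. *)
Definition joint_law (C : set (X * X)) : \bar R := \int[pi]_x P x (xsection C x).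

Lemma measurable_kernel_xsection (C : set (X * X)) : measurable C ->
  measurable_fun [set: X] (fun x => P x (xsection C x)).
Proof. by move=> mC; apply: measurable_fun_xsection_finite_kernel; rewrite inE. Qed.

Lemma measurable_kernel_ysection (C : set (X * X)) : measurable C ->
  measurable_fun [set: X] (fun y => P y (ysection C y)).
Proof.
move=> mC; pose sw (z : X * X) := (z.2, z.1).
have msw : measurable_fun [set: X * X] sw.
  exact: measurable_swap.
have mC' : measurable (sw @^-1` C).
  by rewrite -[X in measurable X]setTI; exact: msw.
rewrite (_ : (fun y => _) = fun x => P x (xsection (sw @^-1` C) x)).
  exact: measurable_kernel_xsection.
by apply/funext => y; congr (P y _); apply/seteqP; split => z;
  rewrite /xsection /ysection /= !inE.
Qed.

Let joint_law0 : joint_law set0 = 0.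
Proof. by apply: integral0_eq => x _; rewrite xsection0 measure0. Qed.

Let joint_law_ge0 C : 0 <= joint_law C.
Proof. by apply: integral_ge0 => x _; exact: measure_ge0. Qed.

Let joint_law_sigma_additive : semi_sigma_additive joint_law.
Proof.
move=> F mF tF mUF; rewrite /joint_law.
rewrite (_ : (fun n => _) = fun n => \int[pi]_x \sum_(0 <= i < n) P x (xsection (F i) x)).
  rewrite (_ : \int[pi]_x _ = \int[pi]_x limn (fun n => \sum_(0 <= i < n) P x (xsection (F i) x))).
    apply: cvg_monotone_convergence => //.
    - by move=> n; apply: emeasurable_sum => i _; exact: measurable_kernel_xsection.
    - by move=> n x _; apply: sume_ge0.
    - by move=> x _ a b ab; apply: lee_sum_nneg_natr.
  apply: eq_integral => x _; apply/esym/cvg_lim => //.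
  rewrite xsection_bigcup; apply: measure_semi_sigma_additive.
  - by move=> i; exact: measurable_xsection.
  - exact: trivIset_xsection.
  - by apply: bigcup_measurable => i _; exact: measurable_xsection.
apply/funext => n; rewrite ge0_integral_sum// => i.
exact: measurable_kernel_xsection.
Qed.

HB.instance Definition _ := isMeasure.Build _ _ _ joint_law
  joint_law0 joint_law_ge0 joint_law_sigma_additive.

Let joint_lawT : joint_law [set: X * X] = 1.
Proof.
rewrite /joint_law; under eq_integral do rewrite xsectionE preimage_setT kernel_setT.
by rewrite integral_cst// mul1e; exact: probability_setT.
Qed.

HB.instance Definition _ := Measure_isProbability.Build _ _ _ joint_law joint_lawT.

Definition pushforward_measure d1 d2 (T1 : measurableType d1) (T2 : measurableType d2)
    (mu : {measure set T1 -> \bar R}) (f : T1 -> T2)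
    (mf : measurable_fun [set: T1] f) : {measure set T2 -> \bar R} :=
  measure_function_pushforward__canonical__measure_function_Measure mu mf.

Lemma integral_joint_law (h : X * X -> \bar R) : (forall z, 0 <= h z) ->
  measurable_fun [set: X * X] h ->
  \int[joint_law]_z h z = \int[pi]_x \int[P x]_y h (x, y).
Proof.
move=> h0 mh.
have mp (x : X) : measurable_fun [set: X] (fun y : X => (x, y)) by exact: (pair1_measurable x).
rewrite (@integral_mixture _ _ _ _ _ pi
  (fun x => pushforward_measure (P x) (mp x)) _ setT)//.
- by apply: eq_integral => x _; rewrite ge0_integral_pushforward.
- move=> C mC; apply: eq_measurable_fun (measurable_kernel_xsection mC) => x _.
  by rewrite /= /pushforward xsectionE.
- by move=> C mC; apply: eq_integral => x _; rewrite /= /pushforward xsectionE.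
Qed.

(** By reversibility the joint law is also the mixture over [y] of the images of [P y] under the map
    sending [x] to [(x, y)]. *)
Lemma integral_joint_law_rev (h : X * X -> \bar R) : reversible P pi ->
  (forall z, 0 <= h z) -> measurable_fun [set: X * X] h ->
  \int[joint_law]_z h z = \int[pi]_y \int[P y]_x h (x, y).
Proof.
move=> rev h0 mh.
have mp (y : X) : measurable_fun [set: X] (fun x : X => (x, y)) by exact: (pair2_measurable y).
rewrite (@integral_mixture _ _ _ _ _ pi
  (fun x => pushforward_measure (P x) (mp x)) _ setT)//.
- by apply: eq_integral => x _; rewrite ge0_integral_pushforward.
- move=> C mC; apply: eq_measurable_fun (measurable_kernel_ysection mC) => x _.
  by rewrite /= /pushforward ysectionE.
- move=> C mC; rewrite -[LHS]/(joint_law C) /joint_law rev//.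
  by apply: eq_integral => x _; rewrite /= /pushforward ysectionE.
Qed.

End joint_law.

Section reversible_operator.
Context (d : measure_display) (R : realType) (X : measurableType d)
  (P : R.-pker X ~> X) (pi : probability X R).
Local Notation T := (kop P).

Lemma integral_kernel_EFin (g : X -> R) x : bmf g ->
  (\int[P x]_y (g y)%:E)%E = (T g x)%:E.
Proof. by move=> bg; rewrite /kop expE//; exact: kernel_setT. Qed.

Lemma integral_kernel_invariant (h : X -> \bar R) : invariant_measure P pi ->
  (forall x, 0 <= h x)%E -> measurable_fun [set: X] h ->
  (\int[pi]_x \int[P x]_y h y = \int[pi]_x h x)%E.
Proof.
move=> inv h0 mh; apply/esym.
apply: (@integral_mixture _ _ _ _ _ pi (fun x => P x) pi setT) => //.
- by move=> B mB; exact: measurable_kernel.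
- by move=> B mB; rewrite inv.
Qed.

Lemma exp_kop_invariant (f : X -> R) : invariant_measure P pi -> bmf f ->
  \int[pi]_x T f x = \int[pi]_x f x.
Proof.
move=> inv bf; have [mf [M hM]] := bf.
(* Shifted by its bound, [f] becomes nonnegative; the shift cancels at the end. *)
have bfM : bmf (fun x => f x + M) by apply: bmfD => //; exact: bmf_cst.
have pi1 : pi [set: X] = 1%E by exact: probability_setT.
have : \int[pi]_x T (fun x => f x + M) x = \int[pi]_x (f x + M).
  apply: EFin_inj; rewrite !expE//; last exact: bmf_kop.
  under eq_integral do rewrite -integral_kernel_EFin//.
  rewrite integral_kernel_invariant//.
  - by move=> x; rewrite lee_fin; have := hM x; rewrite ler_norml => /andP[]; lra.
  - exact/measurable_EFinP/bmf_meas.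
have bc := bmf_cst X M.
rewrite kopD// expD//; auto with bmf.
by rewrite expD// kop_cst => /addIr.
Qed.

Lemma exp_kop_reversible (f g : X -> R) : invariant_measure P pi ->
  reversible P pi -> bmf f -> bmf g ->
  \int[pi]_x (f x * T g x) = \int[pi]_x (T f x * g x).
Proof.
move=> inv rev bf bg; have [mf [M hM]] := bf; have [mg [N hN]] := bg.
have pi1 : pi [set: X] = 1%E by exact: probability_setT.
have bM := bmf_cst X M; have bN := bmf_cst X N.
have pos (h : X -> R) c y : (forall y, `|h y| <= c) -> 0 <= h y + c.
  by move=> /(_ y); rewrite ler_norml => /andP[]; lra.
pose f' x := f x + M; pose g' x := g x + N.
have bf' : bmf f' by exact: bmfD.
have bg' : bmf g' by exact: bmfD.
have : \int[pi]_x (f' x * T g' x) = \int[pi]_x (T f' x * g' x).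
  apply: EFin_inj; rewrite !expE//; [|by auto with bmf|by auto with bmf].
  pose h (z : X * X) := (f' z.1 * g' z.2)%:E.
  have h0 z : (0 <= h z)%E by rewrite lee_fin mulr_ge0// pos.
  have mh : measurable_fun [set: X * X] h.
    apply/measurable_EFinP => /=; apply: measurable_funM.
      by apply: measurableT_comp => //; exact: (bmf_meas bf').
    by apply: measurableT_comp => //; exact: (bmf_meas bg').
  have := integral_joint_law_rev rev h0 mh; rewrite integral_joint_law// /h /=.
  have bc c : bmf (fun y => c * g' y) by exact: bmfZ.
  under eq_integral do rewrite integral_kernel_EFin// kopZ//.
  move=> ->; apply: eq_integral => y _.
  under [LHS]eq_integral do rewrite mulrC.
  by rewrite integral_kernel_EFin; auto with bmf; rewrite kopZ// mulrC.
(* Invariance turns the cross terms produced by the two shifts into the same constants in [e1] and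
   [e2]. *)
have e1 : \int[pi]_x (f' x * T g' x) = \int[pi]_x (f x * T g x) + N * \int[pi]_x f x
    + M * \int[pi]_x g x + M * N.
  rewrite kopD// kop_cst.
  transitivity (\int[pi]_x (f x * T g x + N * f x + M * T g x + M * N)).
    by congr (Rintegral _ _ _); apply/funext => x; rewrite /f'; ring.
  rewrite !expD ?expZ// ?exp_cst//; auto 7 with bmf.
  by rewrite exp_kop_invariant.
have e2 : \int[pi]_x (T f' x * g' x) = \int[pi]_x (T f x * g x) + N * \int[pi]_x f x
    + M * \int[pi]_x g x + M * N.
  rewrite kopD// kop_cst.
  transitivity (\int[pi]_x (T f x * g x + N * T f x + M * g x + M * N)).
    by congr (Rintegral _ _ _); apply/funext => x; rewrite /g'; ring.
  rewrite !expD ?expZ// ?exp_cst//; auto 7 with bmf.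
  by rewrite exp_kop_invariant.
by rewrite e1 e2 => /addIr/addIr/addIr.
Qed.

Lemma bmf_Lfun2 (f : X -> R) : bmf f -> f \in Lfun pi 2%:E.
Proof.
move=> bf; have [mf [M hM]] := bf.
rewrite inE; apply/andP; split; first by rewrite inE.
rewrite inE/= /finite_norm unlock.
apply: poweR_lty.
have bff : bmf (fun x => f x * f x) by exact: bmfM.
rewrite (_ : (\int[pi]_x _)%E = \int[pi]_x (f x * f x)%:E)%E.
  by rewrite -expE ?ltry//; exact: probability_setT.
apply: eq_integral => x _.
by rewrite /= powR_mulrn// -normrX ger0_norm ?sqr_ge0// expr2.
Qed.

Lemma exp_kop_psd (f : X -> R) : nonneg_definite P pi -> bmf f ->
  0 <= \int[pi]_x (f x * T f x).
Proof.
move=> psd bf; have := psd f (bmf_Lfun2 bf).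
under eq_integral do rewrite integral_kernel_EFin// -EFinM.
rewrite -expE ?lee_fin//; last by auto with bmf.
exact: probability_setT.
Qed.

Lemma kop_minorization (nu : probability X R) (A : set X) (delta : R) :
  0 < delta ->
  (forall x B, measurable B -> ((delta * \1_A x)%:E * nu B <= P x B)%E) ->
  forall f x, bmf f -> (forall y, 0 <= f y) ->
  delta * \1_A x * \int[nu]_y f y <= T f x.
Proof.
move=> d0 minor f x bf f0; apply: le_exp_measure => //.
- exact: probability_setT.
- exact: kernel_setT.
- by rewrite mulr_ge0 ?(ltW d0)// indicE; case: (_ \in _).
- by move=> B mB; exact: minor.
Qed.

End reversible_operator.

(** * Functionals of the chain *)

Section markov_chain_functional.
Context (d d' : measure_display) (R : realType)
    (X : measurableType d) (Omega : measurableType d')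
    (P : R.-pker X ~> X)
    (Pr : X -> probability Omega R) (Phi : nat -> {mfun Omega >-> X})
    (chain : is_markov_chain P Pr Phi).
Local Notation T := (kop P).

Lemma history_measurable n : history Phi n `<=` measurable.
Proof.
apply: smallest_sub; first exact: sigma_algebra_measurable.
move=> _ [i _ [B mB <-]]; exact: measurable_funP.
Qed.

Lemma history_setT n : history Phi n setT.
Proof.
have [h0 hC _] := smallest_sigma_algebra [set: Omega] (\bigcup_(i in [set i | (i <= n)%N])
        preimage_set_system [set: Omega] (Phi i) measurable).
by have := hC _ h0; rewrite setD0.
Qed.

Lemma history_setI n H B : history Phi n H -> measurable B ->
  history Phi n.+1 (H `&` Phi n.+1 @^-1` B).
Proof.
move=> hH mB.
have hsub : history Phi n `<=` history Phi n.+1.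
  apply: sub_sigma_algebra2 => _ [i /= ni [C mC <-]]; exists i; last by exists C.
  exact: leqW.
pose G := \bigcup_(i in [set i | (i <= n.+1)%N])
        preimage_set_system [set: Omega] (Phi i) measurable.
apply: (@measurableI _ (g_sigma_algebraType G)); first exact: hsub.
apply: sub_sigma_algebra; exists n.+1 => //=.
by exists B => //; rewrite setTI.
Qed.

(** The law of [Phi n.+1] restricted to [H] is a mixture in two ways: of Dirac masses at
    [Phi n.+1 w] and, by the Markov property, of the measures [P (Phi n w)]. *)
Lemma markov_integral x n H (g : X -> \bar R) : history Phi n H ->
  (forall y, 0 <= g y)%E -> measurable_fun [set: X] g ->
  (\int[Pr x]_(w in H) g (Phi n.+1 w) =
   \int[Pr x]_(w in H) \int[P (Phi n w)]_y g y)%E.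
Proof.
move=> hH g0 mg; have mH := history_measurable hH.
pose m := pushforward_measure (mrestr (Pr x) mH)
  (@measurable_funP _ _ _ _ setT (Phi n.+1)).
have mE B : measurable B -> m B = Pr x (H `&` Phi n.+1 @^-1` B).
  by move=> mB; rewrite /m /= /pushforward /mrestr setIC.
transitivity (\int[m]_y g y)%E.
  rewrite (@integral_mixture _ _ _ _ _ (Pr x) (fun w => \d_(Phi n.+1 w)) _ H)//.
  - by apply: eq_integral => w _; rewrite integral_dirac// diracT mul1e.
  - move=> B mB; apply: (measurableT_comp (measurable_fun_dirac mB)).
    exact: measurable_funP.
  - move=> B mB; rewrite mE//.
    have mPB : measurable (Phi n.+1 @^-1` B) by exact: measurable_funPTI.
    rewrite -[RHS]/(\int[Pr x]_(w in H) (\1_(Phi n.+1 @^-1` B) w)%:E)%E.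
    by rewrite integral_indic// setIC.
rewrite (@integral_mixture _ _ _ _ _ (Pr x) (fun w => P (Phi n w)) _ H)//.
- move=> B mB; apply: (measurableT_comp (measurable_kernel P B mB)).
  exact: measurable_funP.
- by move=> B mB; rewrite mE// (chain_markov chain).
Qed.

Lemma markov_start_integral x (g : X -> \bar R) :
  (forall y, 0 <= g y)%E -> measurable_fun [set: X] g ->
  (\int[Pr x]_w g (Phi 0%N w) = g x)%E.
Proof.
move=> g0 mg; rewrite -(ge0_integral_distribution (Phi 0%N))//.
rewrite (eq_measure_integral (\d_x : {measure set X -> \bar R})).
  by rewrite integral_dirac// diracT mul1e.
by move=> B mB _; exact: (chain_start chain).
Qed.

Lemma bmf_comp (f : X -> R) n : bmf f -> bmf (fun w => f (Phi n w)).
Proof.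
move=> [mf [M hM]]; split; last by exists M.
by apply: (measurableT_comp mf); exact: measurable_funP.
Qed.

Lemma exp_markov_step x n (f : X -> R) : bmf f ->
  \int[Pr x]_w f (Phi n.+1 w) = \int[Pr x]_w T f (Phi n w).
Proof.
move=> bf; have [mf [M hM]] := bf.
have bfM : bmf (fun x => f x + M) by apply: bmfD => //; exact: bmf_cst.
have P1 : Pr x [set: Omega] = 1%E by exact: probability_setT.
have : \int[Pr x]_w (f (Phi n.+1 w) + M) = \int[Pr x]_w (T (fun y => f y + M) (Phi n w)).
  have b1 := bmf_comp n.+1 bfM; have b2 := bmf_comp n (bmf_kop P bfM).
  apply: EFin_inj; rewrite !expE//.
  under [RHS]eq_integral do rewrite -integral_kernel_EFin//.
  rewrite -(@markov_integral x n setT (fun y => (f y + M)%:E))//.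
  - exact: history_setT.
  - by move=> y; rewrite lee_fin; have := hM y; rewrite ler_norml => /andP[]; lra.
  - exact/measurable_EFinP/bmf_meas.
have bc := bmf_cst X M; have bcO := bmf_cst Omega M.
have b1 := bmf_comp n.+1 bf; have b2 := bmf_comp n (bmf_kop P bf).
by rewrite kopD// kop_cst !expD// => /addIr.
Qed.

Lemma exp_markov_start x (f : X -> R) : bmf f -> \int[Pr x]_w f (Phi 0%N w) = f x.
Proof.
move=> bf; have [mf [M hM]] := bf.
have bfM : bmf (fun x => f x + M) by apply: bmfD => //; exact: bmf_cst.
have P1 : Pr x [set: Omega] = 1%E by exact: probability_setT.
have : \int[Pr x]_w (f (Phi 0%N w) + M) = f x + M.
  have b1 := bmf_comp 0%N bfM.
  apply: EFin_inj; rewrite expE//.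
  rewrite (@markov_start_integral x (fun y => (f y + M)%:E))//.
  - by move=> y; rewrite lee_fin; have := hM y; rewrite ler_norml => /andP[]; lra.
  - exact/measurable_EFinP/bmf_meas.
have bcO := bmf_cst Omega M; have b1 := bmf_comp 0%N bf.
by rewrite expD// exp_cst// => /addIr.
Qed.

Lemma exp_nstep n x (f : X -> R) : bmf f ->
  \int[nstep Pr Phi n x]_y f y = iter n T f x.
Proof.
move=> bf; have b1 := bmf_comp n bf.
have P1 : Pr x [set: Omega] = 1%E by exact: probability_setT.
transitivity (\int[Pr x]_w f (Phi n w)).
  congr fine; rewrite integral_distribution//.
  - exact/measurable_EFinP/bmf_meas.
  - by have := bmf_integrable P1 b1.
elim: n f bf {b1} => [|n IHn] f bf; first exact: exp_markov_start.
by rewrite exp_markov_step// iterSr IHn//; exact: bmf_kop.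
Qed.

Lemma nstep_iter_EFin n x (B : set X) : measurable B ->
  nstep Pr Phi n x B = (iter n T \1_B x)%:E.
Proof.
move=> mB; rewrite -exp_nstep ?exp_indic//; last exact: bmf_indic.
exact: probability_setT.
Qed.

Lemma nstep1 x (B : set X) : measurable B -> nstep Pr Phi 1 x B = P x B.
Proof.
move=> mB; rewrite nstep_iter_EFin//= /kop exp_indic//.
exact: kernel_setT.
Qed.

Context (A : set X) (kappa : R).
Hypothesis mA : measurable A.
Hypothesis kappa_gt1 : 1 < kappa.

(** The event [tau_A > j], in a form that visibly belongs to the history up to time [j]. *)
Fixpoint avoids (j : nat) : set Omega :=
  if j is i.+1 then avoids i `&` Phi i.+1 @^-1` (~` A) else setT.

Lemma history_avoids j : history Phi j (avoids j).
Proof.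
elim: j => [|j IHj]; first exact: history_setT.
by apply: history_setI => //; exact: measurableC.
Qed.

Lemma avoidsE j w i : avoids j w -> (0 < i <= j)%N -> ~ A (Phi i w).
Proof.
elim: j => [|j IHj] /=; first by move=> _; lia.
move=> [/IHj aj nA] /andP[i0]; rewrite leq_eqVlt => /predU1P[->//|ij].
by apply: aj; rewrite i0.
Qed.

(** A measurable form of [kappa ^ tau_A]: the largest [m] with [tau_A > m] is [tau_A - 1], whence
    the exponent [m.+1]. *)
Definition hit_pow (w : Omega) : \bar R :=
  ereal_sup (range (fun m => (kappa ^+ m.+1 * \1_(avoids m) w)%:E)).

Lemma measurable_avoids j : measurable (avoids j).
Proof. exact: (@history_measurable j _ (@history_avoids j)). Qed.

Lemma measurable_hit_pow : measurable_fun [set: Omega] hit_pow.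
Proof.
rewrite (_ : hit_pow = fun w => esups (fun m => (kappa ^+ m.+1 * \1_(avoids m) w)%:E) 0).
  apply: measurable_fun_esups => // m; apply/measurable_EFinP.
  by apply: measurable_funM => //; apply: measurable_indic; exact: measurable_avoids.
by apply/funext => w; rewrite /hit_pow /esups/=; congr ereal_sup;
  apply/seteqP; split => _ [m _ <-]; exists m.
Qed.

Lemma hit_pow_lb j w : avoids j w -> ((kappa ^+ j.+1)%:E <= hit_pow w)%E.
Proof.
move=> aj; apply: ereal_sup_ubound; exists j => //.
by rewrite indicE mem_set// mulr1.
Qed.

Lemma hit_pow_ge0 w : (0 <= hit_pow w)%E.
Proof.
rewrite (le_trans _ (@hit_pow_lb 0%N w _))// lee_fin exprn_ge0//.
by rewrite ltW// (lt_trans ltr01).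
Qed.

Lemma hit_pow_le w : (hit_pow w <= ext_pow kappa (hitting_time R Phi A w))%E.
Proof.
have k0 : 0 < kappa by rewrite (lt_trans ltr01).
have ep0 : (0 <= ext_pow kappa (hitting_time R Phi A w))%E.
  rewrite /ext_pow; case: hitting_time => [r| |]//.
  by rewrite lee_fin powR_ge0.
apply: ge_ereal_sup => _ [m _ <-]; rewrite indicE.
have [/set_mem am|_] := boolP (w \in _); last by rewrite mulr0.
rewrite mulr1.
have : (m.+1%:R%:E <= hitting_time R Phi A w)%E.
  apply: le_ereal_inf_tmp => _ [n [n0 An] <-]; rewrite lee_fin ler_nat ltnNge.
  apply/negP => nm; apply: (avoidsE am _ An).
  by rewrite n0.
rewrite /ext_pow; case: hitting_time => [r| |]; [|by move=> _; exact: leey|by rewrite leeNy_eq].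
rewrite !lee_fin => mr; rewrite -powR_mulrn ?(ltW k0)//.
by rewrite ler_powR// ltW.
Qed.

(** The Markov property moves the evaluation to time [j.+1]. If the chain is then in [A], the
    remaining moment is [1] and [hit_pow_lb] suffices; otherwise the event is [avoids j.+1], and the
    recursion of [hit_moment] supplies the next factor [kappa]. *)
Lemma hit_moment_le_hit_pow x m j :
  (\int[Pr x]_(w in avoids j) (kappa ^+ j.+1 * T (hit_moment P A kappa m) (Phi j w))%:E <=
   \int[Pr x]_(w in avoids j) hit_pow w)%E.
Proof.
have k0 : 0 < kappa by rewrite (lt_trans ltr01).
have bh i := bmf_hit_moment P mA kappa i.
have h1 i y : 1 <= hit_moment P A kappa i y by apply: hit_moment_ge1 => //; exact: ltW.
have mav i : measurable (avoids i) by exact: measurable_avoids.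
have mhp D : measurable_fun D hit_pow by exact/measurable_funTS/measurable_hit_pow.
elim: m j => [|m IHm] j.
  apply: ge0_le_integral => //.
  - by move=> w _; rewrite /= kop_cst mulr1 lee_fin exprn_ge0// ltW.
  - by rewrite /= kop_cst; exact: measurable_cst.
  - by move=> w aj; rewrite /= kop_cst mulr1; exact: hit_pow_lb.
set h := hit_moment P A kappa m.+1.
pose g y := (kappa ^+ j.+1 * h y)%:E.
have g0 y : (0 <= g y)%E.
  by rewrite lee_fin mulr_ge0 ?exprn_ge0 ?(ltW k0)// (le_trans ler01)// h1.
have mg : measurable_fun [set: X] g.
  by apply/measurable_EFinP/bmf_meas; apply: bmfZ; exact: bh.
have -> : (\int[Pr x]_(w in avoids j) (kappa ^+ j.+1 * T h (Phi j w))%:E =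
    \int[Pr x]_(w in avoids j) g (Phi j.+1 w))%E.
  rewrite (markov_integral _ (@history_avoids j))//; apply: eq_integral => w _.
  rewrite (integral_kernel_EFin P (g := fun y => kappa ^+ j.+1 * h y)) ?kopZ//; first exact: bh.
  by apply: bmfZ; exact: bh.
have mhit : measurable (avoids j `&` Phi j.+1 @^-1` A).
  by apply: measurableI => //; exact: measurable_funPTI.
have split_av : avoids j = (avoids j `&` Phi j.+1 @^-1` A) `|` avoids j.+1.
  by rewrite /= -setIUr preimage_setC setUv setIT.
have disj : [disjoint avoids j `&` Phi j.+1 @^-1` A & avoids j.+1].
  rewrite disj_set2E; apply/eqP; rewrite -subset0 => w [[_ wA] [_ nwA]].
  exact: nwA.
have mgP : measurable_fun [set: Omega] (fun w => g (Phi j.+1 w)).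
  by apply: (measurableT_comp mg); exact: measurable_funP.
have split_int (f : Omega -> \bar R) : (forall w, 0 <= f w)%E ->
    measurable_fun [set: Omega] f ->
    (\int[Pr x]_(w in avoids j) f w = \int[Pr x]_(w in avoids j `&` Phi j.+1 @^-1` A) f w
      + \int[Pr x]_(w in avoids j.+1) f w)%E.
  move=> f0 mf; rewrite [in LHS]split_av ge0_integral_setU//.
  exact: measurable_funTS.
rewrite !split_int//; [|exact: hit_pow_ge0].
apply: leeD.
  apply: ge0_le_integral => //; first exact: measurable_funTS.
  move=> w [aj wA]; rewrite /g /h hit_moment_in// mulr1; exact: hit_pow_lb.
apply: le_trans (IHm j.+1); rewrite le_eqVlt; apply/orP; left; apply/eqP.
apply: eq_integral => w; rewrite inE => -[_ nwA].
by rewrite /g /h hit_moment_out// mulrA -exprSr.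
Qed.

Lemma kop_hit_moment_le_sup x m : A x ->
  (sup_hitting_moment Pr Phi A kappa < +oo)%E ->
  kappa * T (hit_moment P A kappa m) x <= fine (sup_hitting_moment Pr Phi A kappa).
Proof.
move=> Ax Lfin; have k0 : 0 < kappa by rewrite (lt_trans ltr01).
have bh i := bmf_hit_moment P mA kappa i.
have h1 i y : 1 <= hit_moment P A kappa i y by apply: hit_moment_ge1 => //; exact: ltW.
have bT := bmf_kop P (bh m).
have T0 y : 0 <= T (hit_moment P A kappa m) y.
  by apply: Rintegral_ge0 => z _; rewrite (le_trans ler01)// h1.
have le1 : ((kappa * T (hit_moment P A kappa m) x)%:E <=
    sup_hitting_moment Pr Phi A kappa)%E.
  apply: (@le_trans _ _ (\int[Pr x]_w ext_pow kappa (hitting_time R Phi A w))%E);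
    last by apply: ereal_sup_ubound; exists x.
  (* Monotonicity is read off the simple functions below the two integrands, as no measurability of
     the hitting time has been established. *)
  apply: (@le_trans _ _ (\int[Pr x]_w hit_pow w)%E); last first.
    rewrite ge0_integralTE; last by move=> w; exact: hit_pow_ge0.
    rewrite ge0_integralTE; last first.
      by move=> w; rewrite (le_trans _ (hit_pow_le w))// hit_pow_ge0.
    apply: le_ereal_sup => _ [h hf <-]; exists h => // w.
    exact: le_trans (hit_pow_le w).
  have := hit_moment_le_hit_pow x m 0; rewrite /= expr1.
  rewrite (@markov_start_integral x
    (fun y => (kappa * T (hit_moment P A kappa m) y)%:E))//.
  - by move=> y; rewrite lee_fin mulr_ge0// ltW.
  - by apply/measurable_EFinP/bmf_meas; exact: bmfZ.
have fin : sup_hitting_moment Pr Phi A kappa \is a fin_num.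
  rewrite ge0_fin_numE// (le_trans _ le1)// lee_fin mulr_ge0// ltW//.
by rewrite -lee_fin fineK.
Qed.

End markov_chain_functional.

(** * Integrability of the limit drift function *)

Section monotone_limit.
Context (d : measure_display) (R : realType) (X : measurableType d)
  (h : nat -> X -> \bar R).
Local Open Scope ereal_scope.
Hypothesis h_ge0 : forall n x, 0 <= h n x.
Hypothesis h_nd : forall n x, h n x <= h n.+1 x.
Hypothesis mh : forall n, measurable_fun [set: X] (h n).

Definition sup_seq (x : X) : \bar R := limn (fun n => h n x).

Let h_nds x : nondecreasing_seq (fun n => h n x).
Proof. by apply/nondecreasing_seqP => n; exact: h_nd. Qed.

Let h_cvg x : cvgn (fun n => h n x).
Proof. exact: ereal_nondecreasing_is_cvgn. Qed.

Lemma sup_seq_ub n x : h n x <= sup_seq x.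
Proof.
apply: lime_ge => //; near=> m; apply: h_nds.
by near: m; exists n.
Unshelve. all: by end_near. Qed.

Lemma sup_seq_le c x : (forall n, h n x <= c) -> sup_seq x <= c.
Proof. by move=> hc; apply: lime_le => //; exact: nearW. Qed.

Lemma sup_seq_ge0 x : 0 <= sup_seq x.
Proof. exact: le_trans (h_ge0 0%N x) (sup_seq_ub 0%N x). Qed.

Lemma measurable_sup_seq : measurable_fun [set: X] sup_seq.
Proof. by apply: (emeasurable_fun_cvg h) => // x _; exact: h_cvg. Qed.

Lemma integral_sup_seq_le (m : {measure set X -> \bar R}) c :
  (forall n, \int[m]_x h n x <= c) -> \int[m]_x sup_seq x <= c.
Proof.
move=> hc; rewrite monotone_convergence//.
apply: lime_le; last exact: nearW.
apply: ereal_nondecreasing_is_cvgn; apply/nondecreasing_seqP => n.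
by apply: ge0_le_integral.
Qed.

End monotone_limit.

Section drift_integral_bound.
Context (d : measure_display) (R : realType) (X : measurableType d)
  (P : R.-pker X ~> X) (pi : probability X R) (phi : nat -> X -> R) (K L : R).
Local Notation T := (kop P).
Hypothesis pi_inv : invariant_measure P pi.
Hypothesis bmf_phi : forall n, bmf (phi n).
Hypothesis phi_ge0 : forall n x, 0 <= phi n x.
Hypothesis phi_nd : forall n x, phi n x <= phi n.+1 x.
Hypothesis K_gt1 : 1 < K.
Hypothesis L_ge0 : 0 <= L.
Hypothesis drift : forall n x, K * T (phi n) x <= phi n.+1 x + L.

Let h n x := (phi n x)%:E.
Let h_ge0 n x : (0 <= h n x)%E. Proof. by rewrite lee_fin. Qed.
Let h_nd n x : (h n x <= h n.+1 x)%E. Proof. by rewrite lee_fin. Qed.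
Let mh n : measurable_fun [set: X] (h n).
Proof. exact/measurable_EFinP/bmf_meas. Qed.
Let Phi := sup_seq h.
Let mPhi : measurable_fun [set: X] Phi. Proof. exact: measurable_sup_seq. Qed.
Let Phi0 x : (0 <= Phi x)%E. Proof. exact: sup_seq_ge0. Qed.
Let K0 : 0 < K. Proof. exact: lt_trans ltr01 K_gt1. Qed.

Definition finite_drift : set X := [set x | (Phi x < +oo)%E].

Lemma measurable_finite_drift : measurable finite_drift.
Proof.
rewrite /finite_drift -[X in measurable X]setTI.
exact: emeasurable_fun_infty_o.
Qed.

Lemma kernel_sup_le x t : (Phi x <= t%:E)%E ->
  (\int[P x]_y Phi y <= ((t + L) / K)%:E)%E.
Proof.
move=> xt; apply: integral_sup_seq_le => // n.
rewrite /h integral_kernel_EFin// lee_fin ler_pdivlMr// mulrC.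
rewrite (le_trans (drift _ _))// lerD2r -lee_fin (le_trans _ xt)//.
exact: (@sup_seq_ub _ _ _ h).
Qed.

(** Where [Phi x] is finite the drift makes [Phi] integrable under [P x], hence finite almost
    everywhere for [P x]. *)
Lemma finite_drift_absorbing x : finite_drift x -> P x (~` finite_drift) = 0%E.
Proof.
move=> Fx.
have Ffin : Phi x \is a fin_num by rewrite ge0_fin_numE.
have := @kernel_sup_le x (fine (Phi x)); rewrite fineK// lexx => /(_ isT) le1.
have intPhi : (P x).-integrable [set: X] Phi.
  apply/integrableP; split => //.
  under eq_integral do rewrite gee0_abs//.
  by rewrite (le_lt_trans le1) ?ltry.
have [N [mN N0 subN]] := integrable_ae measurableT intPhi.
have mFc : measurable (~` finite_drift).
  by apply: measurableC; exact: measurable_finite_drift.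
apply/eqP; rewrite -measure_le0 -N0 le_measure ?inE// => y /= nF.
apply: subN => /= /(_ Logic.I); rewrite ge0_fin_numE//.
Qed.

(** Integrating [K P Phi <= Phi + L] directly would require [pi Phi] to be finite. With [m] the
    minimum of [Phi] and [c], the sum of [P m] and of [(1 - K^-1) Phi] restricted to [Phi <= c] is
    at most [m + L / K]; invariance then cancels [pi m], which is finite. *)
Lemma truncated_sup_integral_le (n : nat) :
  (\int[pi]_x (Phi \_ [set x | Phi x <= n%:R%:E]) x <= (L / (K - 1))%:E)%E.
Proof.
set c := (n%:R : R); set D := [set x | _].
have c0 : 0 <= c by rewrite /c.
have mD : measurable D.
  by rewrite /D -[X in measurable X]setTI; exact: emeasurable_fun_infty_c.
pose m x := mine (Phi x) c%:E.
have m0 x : (0 <= m x)%E by rewrite /m le_min Phi0 lee_fin.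
have mm : measurable_fun [set: X] m by apply: measurable_mine.
have mPm : measurable_fun [set: X] (fun x => \int[P x]_y m y)%E.
  by apply: measurable_fun_integral_kernel => // U mU; exact: measurable_kernel.
have Pm0 x : (0 <= \int[P x]_y m y)%E by apply: integral_ge0.
have k0 : 0 <= 1 - K^-1 by rewrite subr_ge0 invf_le1// ltW.
have mPhiD : measurable_fun [set: X] (Phi \_ D).
  by apply/(measurable_restrictT _ _).1 => //; exact: measurable_funTS.
have PhiD0 x : (0 <= (Phi \_ D) x)%E by apply: erestrict_ge0.
have Pmc x : (\int[P x]_y m y <= c%:E)%E.
  apply: (@le_trans _ _ (\int[P x]_y c%:E)%E).
    by apply: ge0_le_integral => // y _; rewrite /m ge_min lexx orbT.
  by rewrite integral_cst// kernel_setT mule1.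
have pt x : (\int[P x]_y m y + (1 - K^-1)%:E * (Phi \_ D) x <= m x + (L / K)%:E)%E.
  have LK : 0 <= L / K by rewrite divr_ge0// ltW.
  rewrite patchE; case: ifPn => [/set_mem xc|/negP xc].
    have Ffin : Phi x \is a fin_num by rewrite ge0_fin_numE// (le_lt_trans xc) ?ltry.
    have [t PxE] : exists t, Phi x = t%:E by exists (fine (Phi x)); rewrite fineK.
    have xF : (\int[P x]_y m y <= ((t + L) / K)%:E)%E.
      apply: (@le_trans _ _ (\int[P x]_y Phi y)%E).
        by apply: ge0_le_integral => // y _; rewrite /m ge_min lexx.
      by apply: kernel_sup_le; rewrite PxE.
    have -> : m x = t%:E by rewrite /m -PxE min_l.
    apply: (le_trans (leeD xF (lexx _))).
    rewrite PxE -EFinM -!EFinD lee_fin le_eqVlt; apply/orP; left; apply/eqP; ring.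
  rewrite mule0 adde0 (le_trans (Pmc x))//.
  rewrite /m min_r ?leeDl//.
  by rewrite leNgt; apply/negP => h1; apply: xc; apply/mem_set; exact: ltW.
have : (\int[pi]_x m x + (1 - K^-1)%:E * \int[pi]_x (Phi \_ D) x <=
        \int[pi]_x m x + (L / K)%:E)%E.
  rewrite -{1}(integral_kernel_invariant pi_inv)//.
  rewrite -ge0_integralZl//.
  rewrite -ge0_integralD//; last 2 first.
  - by move=> x _; rewrite mule_ge0// lee_fin.
  - exact: measurable_funeM.
  have -> : (L / K)%:E = (\int[pi]_x (L / K)%:E)%E.
    by rewrite integral_cst// [X in (_ * X)%E](_ : _ = 1%E) ?mule1//; exact: probability_setT.
  rewrite -ge0_integralD//; last by move=> x _; rewrite lee_fin divr_ge0// ltW.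
  apply: ge0_le_integral => //.
  - by move=> x _; rewrite adde_ge0// mule_ge0// lee_fin.
  - by apply: emeasurable_funD => //; exact: measurable_funeM.
  - exact: emeasurable_funD.
have mfin : (\int[pi]_x m x)%E \is a fin_num.
  rewrite ge0_fin_numE; last by apply: integral_ge0.
  apply: (@le_lt_trans _ _ (\int[pi]_x c%:E)%E); last first.
    rewrite integral_cst// [X in (_ * X)%E](_ : _ = 1%E) ?mule1 ?ltry//.
    exact: probability_setT.
  by apply: ge0_le_integral => // y _; rewrite /m ge_min lexx orbT.
rewrite leeD2lE// => le1.
have k1 : 0 < 1 - K^-1 by rewrite subr_gt0 invf_lt1.
move: le1; rewrite -lee_pdivlMl// => /le_trans; apply.
rewrite -EFinM lee_fin le_eqVlt; apply/orP; left; apply/eqP; field.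
by rewrite subr_eq0 !gt_eqF.
Qed.

Hypothesis pi_finite : pi (~` finite_drift) = 0%E.

(** The sets [Phi <= i] increase to [finite_drift], which has full measure, and the truncated bound
    is uniform in [i]. *)
Lemma drift_integral_le n : \int[pi]_x phi n x <= L / (K - 1).
Proof.
rewrite -lee_fin expE//; last exact: probability_setT.
pose F i := [set x | (Phi x <= i%:R%:E)%E].
have mF i : measurable (F i).
  by rewrite /F -[X in measurable X]setTI; exact: emeasurable_fun_infty_c.
have FE : \bigcup_i F i = finite_drift.
  apply/seteqP; split => x; rewrite /finite_drift /F /=.
    by move=> [i _ /= xi]; rewrite (le_lt_trans xi) ?ltry.
  move=> xoo; have Ffin : Phi x \is a fin_num by rewrite ge0_fin_numE.
  exists (Num.bound (fine (Phi x))) => //=.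
  by rewrite -(fineK Ffin) lee_fin ltW// archi_boundP// fine_ge0.
have -> : (\int[pi]_x (phi n x)%:E = \int[pi]_(x in finite_drift) (phi n x)%:E)%E.
  rewrite -[X in _ = (\int[_]_(x in X) _)%E]setTI -[finite_drift]setCK.
  rewrite -setDE (ge0_negligible_integral _ _ _ _ pi_finite)//.
  - by apply: measurableC; exact: measurable_finite_drift.
  - exact: mh.
  - by move=> x _; exact: h_ge0.
rewrite -FE.
have ndF : nondecreasing_seq F.
  by apply/nondecreasing_seqP => i; rewrite subsetEset => x /= xi;
    apply: (le_trans xi); rewrite lee_fin ler_nat.
have /cvg_lim <- // := @ge0_nondecreasing_set_cvg_integral _ _ _ F
  (fun x => (phi n x)%:E) pi ndF mF (fun i => measurable_funTS (mh n))
  (fun i x _ => h_ge0 n x).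
apply: lime_le.
  apply: ereal_nondecreasing_is_cvgn.
  apply: ge0_nondecreasing_set_nondecreasing_integral => // [i|i x _].
    exact: (measurable_funTS (mh n)).
  exact: h_ge0.
apply: nearW => i; apply: le_trans (truncated_sup_integral_le i).
rewrite integral_mkcond; apply: ge0_le_integral => //.
- by move=> x _; apply: erestrict_ge0 => y _; exact: h_ge0.
- by apply/(measurable_restrictT _ (mF i)).1; exact: (measurable_funTS (mh n)).
- by apply/(measurable_restrictT _ (mF i)).1; exact: (measurable_funTS mPhi).
move=> x _; apply: lee_restrict => y _; exact: (@sup_seq_ub _ _ _ h).
Qed.

End drift_integral_bound.

(** * Absorbing sets of an irreducible chain *)

Section finite_drift_full.
Context (d d' : measure_display) (R : realType)
    (X : measurableType d) (Omega : measurableType d')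
    (P : R.-pker X ~> X) (pi : probability X R)
    (Pr : X -> probability Omega R) (Phi : nat -> {mfun Omega >-> X})
    (chain : is_markov_chain P Pr Phi) (irr : irreducible pi Pr Phi).

(** From a point of [F] no power of the kernel charges the complement, whereas irreducibility would
    charge it if its measure were positive. *)
Lemma absorbing_full (F : set X) : measurable F -> F !=set0 ->
  (forall x, F x -> P x (~` F) = 0%E) -> pi (~` F) = 0%E.
Proof.
move=> mF [x0 Fx0] absF; have mFc := measurableC mF.
apply/eqP; rewrite eq_le measure_ge0 andbT leNgt; apply/negP => piF.
have [n _] := irr mFc piF x0.
suff : forall x, F x -> iter n (kop P) \1_(~` F) x = 0.
  by move=> /(_ x0 Fx0) h; rewrite (nstep_iter_EFin chain)// h ltxx.
have b1 : bmf (\1_(~` F) : X -> R) by exact: bmf_indic.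
elim: n => [|n IHn] x Fx.
  by rewrite /= indicE memNset.
have bn := bmf_iter_kop P n b1.
rewrite /= /kop; apply: EFin_inj; rewrite expE//; last exact: kernel_setT.
rewrite (ae_eq_integral (cst 0%E))//.
- by rewrite integral_cst// mul0e.
- exact/measurable_EFinP/bmf_meas.
- exists (~` F); split => //; first exact: absF.
  by move=> y /= h Fy; apply: h => _; rewrite IHn.
Qed.

End finite_drift_full.

(** * A symmetric transition density *)

(** Finite intersections of generators are enumerated by encoding finite sequences of indices.
    Countability lets exceptional null sets be united, and stability under intersection lets
    uniqueness of measures apply. *)
Lemma countably_generated_setI_closed (d : measure_display) (X : measurableType d) :
  countably_generated X -> exists g : nat -> set X,
    [/\ setI_closed (range g), range g setT & @measurable d X = <<s range g >>].
Proof.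
move=> [G [cG mG]].
have [e [eG Ge]] : exists e : nat -> set X,
    (forall B, G B -> exists n, e n = B) /\ forall n, G (e n) \/ e n = setT.
  have /countable_injP[f finj] := cG.
  (* Codes of no generator are sent to [setT], which is neutral for intersections. *)
  exists (fun n => xget setT [set B | G B /\ f B = n]); split.
    move=> B GB; exists (f B); have [_ -> [GC fCB]|/(_ B)] := xgetP; last by case.
    by apply: finj; rewrite ?inE.
  move=> n; have [B -> [GB _]|_] := xgetP; first by left.
  by right.
pose g n := \big[setI/setT]_(i <- odflt [::] (unpickle n : option (seq nat))) e i.
have gE (s : seq nat) : g (pickle s) = \big[setI/setT]_(i <- s) e i.
  by rewrite /g pickleK.
exists g; split.
- move=> _ _ [n _ <-] [m _ <-].
  exists (pickle (odflt [::] (unpickle n : option (seq nat)) ++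
                  odflt [::] (unpickle m : option (seq nat)))) => //.
  by rewrite gE big_cat.
- by exists (pickle ([::] : seq nat)) => //; rewrite gE big_nil.
- rewrite mG; apply/seteqP; split.
    apply: smallest_sub; first exact: smallest_sigma_algebra.
    move=> B GB; have [n nB] := eG _ GB.
    have : range g B by exists (pickle [:: n]) => //; rewrite gE big_seq1.
    exact: sub_sigma_algebra.
  apply: smallest_sub; first exact: smallest_sigma_algebra.
  move=> _ [n _ <-]; rewrite /g; elim: (odflt _ _) => [|i s IHs].
    by rewrite big_nil; rewrite -mG; exact: measurableT.
  rewrite big_cons -mG; apply: measurableI; last by rewrite mG.
  have [Gi| ->] := Ge i; last exact: measurableT.
  by rewrite mG; exact: sub_sigma_algebra.
Qed.

Section density_measure.
Context (d : measure_display) (R : realType) (X : measurableType d).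
Local Open Scope ereal_scope.

(** The two side conditions are parameters so that the measure structure can be attached to the
    term. *)
Definition density (mu : {measure set X -> \bar R}) (q : X -> R)
    of (forall x, 0 <= q x)%R & measurable_fun [set: X] q : set X -> \bar R :=
  fun B => \int[mu]_(x in B) (q x)%:E.

Context (mu : {measure set X -> \bar R}) (q : X -> R)
  (q0 : forall x, (0 <= q x)%R) (mq : measurable_fun [set: X] q).

Let density0 : density mu q0 mq set0 = 0.
Proof. by rewrite /density integral_set0. Qed.

Let density_ge0 B : 0 <= density mu q0 mq B.
Proof. by apply: integral_ge0 => x _; rewrite lee_fin. Qed.

Let density_sigma_additive : semi_sigma_additive (density mu q0 mq).
Proof.
apply: semi_sigma_additive_nng_induced; first exact/measurable_EFinP.
by move=> x; rewrite lee_fin.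
Qed.

HB.instance Definition _ := isMeasure.Build _ _ _ (density mu q0 mq)
  density0 density_ge0 density_sigma_additive.

End density_measure.

Section symmetric_density.
Context (d : measure_display) (R : realType) (X : measurableType d)
  (P : R.-pker X ~> X) (pi : probability X R).
Hypothesis X_cg : countably_generated X.
Hypothesis pi_rev : reversible P pi.
Hypothesis ac : forall x B, measurable B -> pi B = 0%E -> P x B = 0%E.
Local Open Scope ereal_scope.
Local Notation M := (pi \x pi).

(** Almost every section of a null set of the product is null for [pi], hence null for [P x]. *)
Lemma joint_law_dominated : joint_law P pi `<< M.
Proof.
apply/null_content_dominatesP => C mC.
rewrite /product_measure1 /= => MC0.
have m1 : measurable_fun [set: X] (fun x => pi (xsection C x)).
  exact: measurable_fun_xsection.
have /ae_eq_integral_abs : \int[pi]_x `|pi (xsection C x)| = 0.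
  by under eq_integral do rewrite gee0_abs//.
move=> /(_ measurableT m1) [N [mN N0 sub]].
rewrite /joint_law (ge0_ae_eq_integral (g := cst 0))//.
- by rewrite integral0.
- exact: measurable_kernel_xsection.
- exists N; split => // x /= h; apply: sub => /= h'; apply: h => _.
  apply: ac; first exact: measurable_xsection.
  exact: h'.
Qed.

Lemma integral_product_swap (h : X * X -> \bar R) : (forall z, 0 <= h z) ->
  measurable_fun [set: X * X] h ->
  \int[M]_z h (z.2, z.1) = \int[M]_z h z.
Proof.
move=> h0 mh.
have msw : measurable_fun [set: X * X] (fun z : X * X => (z.2, z.1)).
  exact: measurable_swap.
have mh' : measurable_fun [set: X * X] (fun z : X * X => h (z.2, z.1)).
  exact: (measurableT_comp mh msw).
by rewrite (fubini_tonelli2 (fun z : X * X => h (z.2, z.1)))// (fubini_tonelli1 h).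
Qed.

(** The Radon-Nikodym density of the joint law is averaged with its transpose, which is a density of
    the same law by reversibility. *)
Lemma symmetric_density_exists : exists p : X * X -> R,
  [/\ forall z, (0 <= p z)%R, measurable_fun [set: X * X] p,
      forall x y, p (x, y) = p (y, x) &
      forall C, measurable C -> joint_law P pi C = \int[M]_(z in C) (p z)%:E].
Proof.
have [f [f0 ffin intf fE]] := @radon_nikodym_sigma_finite _ _ _
  (pi \x pi : probability (X * X)%type R)
  (joint_law P pi : probability (X * X)%type R) joint_law_dominated.
have mf : measurable_fun [set: X * X] f by exact: measurable_int intf.
pose q z := fine (f z).
have qE z : (q z)%:E = f z by rewrite fineK.
have q0 z : (0 <= q z)%R by rewrite -lee_fin qE.
have mq : measurable_fun [set: X * X] q by exact: measurableT_comp.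
have msw : measurable_fun [set: X * X] (fun z : X * X => (z.2, z.1)).
  exact: measurable_swap.
exists (fun z => (q z + q (z.2, z.1)) / 2)%R; split.
- by move=> z; rewrite divr_ge0// addr_ge0.
- by apply: measurable_funM => //; apply: measurable_funD => //; exact: (measurableT_comp mq msw).
- by move=> x y /=; rewrite addrC.
move=> C mC; pose C' := (fun z : X * X => (z.2, z.1)) @^-1` C.
have mC' : measurable C' by rewrite /C' -[X in measurable X]setTI; exact: msw.
have h1 : \int[M]_(z in C) (q z)%:E = joint_law P pi C.
  by rewrite fE//; apply: eq_integral => z _; rewrite qE.
have h2 : \int[M]_(z in C) (q (z.2, z.1))%:E = joint_law P pi C.
  transitivity (joint_law P pi C').
    rewrite fE// integral_mkcond [RHS]integral_mkcond.
    rewrite -[RHS]integral_product_swap.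
    - apply: eq_integral => -[x y] _; rewrite !patchE /= qE.
      by congr (if _ then _ else _); apply/idP/idP; rewrite !inE.
    - by move=> z; apply: erestrict_ge0.
    - apply: (measurable_restrictT f mC').1; exact: (measurable_funTS mf).
  by rewrite /joint_law pi_rev.
have e z : ((q z + q (z.2, z.1)) / 2)%:E = (2^-1)%:E * ((q z)%:E + (q (z.2, z.1))%:E).
  by rewrite -EFinD -EFinM mulrC.
under eq_integral do rewrite e.
have mqs : measurable_fun [set: X * X] (fun z : X * X => q (z.2, z.1)).
  exact: (measurableT_comp mq msw).
rewrite ge0_integralZl//; last 2 first.
- by apply: measurable_funTS; apply: emeasurable_funD; exact/measurable_EFinP.
- by move=> z _; rewrite adde_ge0// lee_fin.
rewrite ge0_integralD//; last 4 first.
- by move=> z _; rewrite lee_fin.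
- by apply: measurable_funTS; exact/measurable_EFinP.
- by move=> z _; rewrite lee_fin.
- by apply: measurable_funTS; exact/measurable_EFinP.
rewrite h1 h2.
have Jfin : joint_law P pi C \is a fin_num by exact: fin_num_measure.
rewrite -(fineK Jfin) -EFinD -EFinM; congr (_%:E).
by move: (fine _) => r; field.
Qed.

(** Testing on the rectangles with sides [D] and [g n] gives the identity at [g n] for almost every
    [x]. The countably many exceptional sets are united, and finite measures agreeing on the
    intersection-stable generator [range g] coincide. *)
Lemma kernel_density : exists p : X * X -> R,
  [/\ forall z, (0 <= p z)%R, measurable_fun [set: X * X] p,
      forall x y, p (x, y) = p (y, x) &
      {ae pi, forall x, forall B, measurable B ->
         P x B = \int[pi]_(y in B) (p (x, y))%:E}].
Proof.
have [p [p0 mp psym pE]] := symmetric_density_exists.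
exists p; split => //.
have [g [gI gT mg]] := countably_generated_setI_closed X_cg.
have mgn n : measurable (g n) by rewrite mg; apply: sub_sigma_algebra; exists n.
have mpx x : measurable_fun [set: X] (fun y => p (x, y)).
  exact: (measurableT_comp mp (pair1_measurable x)).
have mpB B : measurable B -> measurable_fun [set: X] (fun x => \int[pi]_(y in B) (p (x, y))%:E).
  move=> mB; pose h (z : X * X) := (p z)%:E * (\1_B z.2)%:E.
  rewrite (_ : (fun x => _) = fubini_F pi h).
    apply: measurable_fun_fubini_tonelli_F.
    - apply: emeasurable_funM; first exact/measurable_EFinP.
      apply/measurable_EFinP; apply: (measurableT_comp (measurable_indic mB)).
      exact: measurable_snd.
    - by move=> z; rewrite mule_ge0// lee_fin.
  apply/funext => x; rewrite /fubini_F [LHS]integral_mkcond; apply: eq_integral => y _.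
  by rewrite /h patchE /= indicE; case: (y \in B); rewrite ?mule1 ?mule0.
have aeg n : {ae pi, forall x, P x (g n) = \int[pi]_(y in g n) (p (x, y))%:E}.
  have intP : pi.-integrable [set: X] (fun x => P x (g n)).
    apply/integrableP; split; first exact: measurable_kernel.
    apply: (@le_lt_trans _ _ (\int[pi]_x 1)); last first.
      by rewrite integral_cst// mul1e [ltLHS](_ : _ = 1)%E ?ltry//; exact: probability_setT.
    apply: ge0_le_integral => //.
      by apply: measurableT_comp => //; exact: measurable_kernel.
    move=> x _; rewrite gee0_abs// -(kernel_setT P x).
    by apply: le_measure; rewrite ?inE.
  have := integral_ae_eq measurableT intP (mpB _ (mgn n)).
  move=> h; have : ae_eq pi setT (fun x => P x (g n)) (fun x => \int[pi]_(y in g n) (p (x, y))%:E).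
    apply: h => D _ mD.
    have := pE (D `*` g n) (measurableX mD (mgn n)).
    have -> : joint_law P pi (D `*` g n) = \int[pi]_(x in D) P x (g n).
      rewrite /joint_law integral_mkcond; rewrite [RHS]integral_mkcond.
      apply: eq_integral => x _; rewrite !patchE in_setT.
      by case: ifPn => xD; [rewrite in_xsectionX|rewrite notin_xsectionX// measure0].
    move=> ->; rewrite [LHS]integral_mkcond.
    rewrite (fubini_tonelli1 ((fun z => (p z)%:E) \_ (D `*` g n)))//; last 2 first.
    - apply/(measurable_restrictT _ _).1; first exact: measurableX.
      by apply: measurable_funTS; exact/measurable_EFinP.
    - by move=> z; apply: erestrict_ge0 => y _; rewrite lee_fin.
    rewrite [RHS]integral_mkcond; apply: eq_integral => x _.
    rewrite /fubini_F [RHS]patchE; case: ifPn => xD.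
      rewrite [RHS]integral_mkcond; apply: eq_integral => y _.
      by rewrite !patchE in_setX xD.
    by rewrite integral0_eq// => y _; rewrite patchE in_setX (negbTE xD).
  apply: filterS => x; exact.
apply: filterS (ae_foralln aeg) => x xg B mB.
have p0x y : (0 <= p (x, y))%R by exact: p0.
rewrite -[RHS]/(density pi p0x (mpx x) B).
apply: (measure_unique (range g) (fun=> setT)) => //.
- by apply/seteqP; split => // y _; exists 0%N.
- by move=> _ [n _ <-]; rewrite xg.
- by move=> _; rewrite kernel_setT ltry.
Qed.

End symmetric_density.

(** * Truncation of the density *)

Section truncated_density.
Context (d : measure_display) (R : realType) (X : measurableType d)
  (P : R.-pker X ~> X) (pi nu : probability X R) (A : set X) (delta K : R)
  (phi : nat -> X -> R) (Cpi pA : R) (p : X * X -> R).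
Local Notation T := (kop P).
Local Open Scope ereal_scope.
Hypothesis mA : measurable A.
Hypothesis pi_inv : invariant_measure P pi.
Hypothesis pA_gt0 : (0 < pA)%R.
Hypothesis pAE : pi A = pA%:E.
Hypothesis delta_gt0 : (0 < delta)%R.
Hypothesis K_gt1 : (1 < K)%R.
Hypothesis minor : forall x B, measurable B -> (delta * \1_A x)%:E * nu B <= P x B.
Hypothesis p0 : forall z, (0 <= p z)%R.
Hypothesis mp : measurable_fun [set: X * X] p.
Hypothesis psym : forall x y, p (x, y) = p (y, x).

Definition has_density x := forall B, measurable B ->
  P x B = \int[pi]_(y in B) (p (x, y))%:E.

Hypothesis ae_density : {ae pi, forall x, has_density x}.

Let K0 : (0 < K)%R. Proof. exact: lt_trans ltr01 K_gt1. Qed.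
Let pi1 : pi [set: X] = 1. Proof. exact: probability_setT. Qed.
Let nu1 : nu [set: X] = 1. Proof. exact: probability_setT. Qed.

(* Any level above [1 / pA] would do, as [delta] times the density of [nu] is
   at most [1 / pA]. *)
Definition level : R := (2 / pA)%R.
Definition trunc (z : X * X) : R := Num.min (p z) level.
Definition excess (z : X * X) : R := (p z - trunc z)%R.

Let level_gt0 : (0 < level)%R. Proof. by rewrite divr_gt0. Qed.

Lemma trunc_ge0 z : (0 <= trunc z)%R.
Proof. by rewrite /trunc le_min p0 ltW. Qed.

Lemma trunc_le z : (trunc z <= level)%R.
Proof. by rewrite /trunc ge_min lexx orbT. Qed.

Lemma excess_ge0 z : (0 <= excess z)%R.
Proof. by rewrite subr_ge0 /trunc ge_min lexx. Qed.

Lemma excess_sym x y : excess (x, y) = excess (y, x).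
Proof. by rewrite /excess /trunc psym. Qed.

Lemma measurable_trunc : measurable_fun [set: X * X] trunc.
Proof. by apply: measurable_minr. Qed.

Lemma measurable_excess : measurable_fun [set: X * X] excess.
Proof. by apply: measurable_funB => //; exact: measurable_trunc. Qed.

Let mpx x : measurable_fun [set: X] (fun y => p (x, y)).
Proof. exact: (measurableT_comp mp (pair1_measurable x)). Qed.
Let mtx x : measurable_fun [set: X] (fun y => trunc (x, y)).
Proof. exact: (measurableT_comp measurable_trunc (pair1_measurable x)). Qed.
Let mex x : measurable_fun [set: X] (fun y => excess (x, y)).
Proof. exact: (measurableT_comp measurable_excess (pair1_measurable x)). Qed.

Lemma kernel_integral_density x (h : X -> \bar R) : has_density x ->
  (forall y, 0 <= h y) -> measurable_fun [set: X] h ->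
  \int[P x]_y h y = \int[pi]_y ((excess (x, y))%:E * h y)
     + \int[pi]_y ((trunc (x, y))%:E * h y).
Proof.
move=> gx h0 mh.
rewrite (@integral_density _ _ _ pi (P x) (fun y => p (x, y)))//.
rewrite -ge0_integralD//.
- apply: eq_integral => y _; rewrite -ge0_muleDl ?lee_fin ?excess_ge0 ?trunc_ge0//.
  by rewrite -EFinD subrK.
- by move=> y _; rewrite mule_ge0// lee_fin excess_ge0.
- by apply: emeasurable_funM => //; apply/measurable_EFinP.
- by move=> y _; rewrite mule_ge0// lee_fin trunc_ge0.
- by apply: emeasurable_funM => //; apply/measurable_EFinP.
Qed.

(** By invariance [pi D] is the integral of [P x D], whose part over [A] is at least
    [delta pA nu D]. *)
Lemma nu_dominated D : measurable D -> (delta * pA)%:E * nu D <= pi D.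
Proof.
move=> mD; rewrite -(pi_inv mD).
apply: (@le_trans _ _ (\int[pi]_x ((delta%:E * nu D) * (\1_A x)%:E))).
  rewrite ge0_integralZl//; last 2 first.
  - exact/measurable_EFinP/measurable_indic.
  - by rewrite mule_ge0// lee_fin ltW.
  rewrite integral_indic// setIT [X in _ <= _ * X](_ : _ = pA%:E); last exact: pAE.
  by rewrite EFinM -!muleA [pA%:E * _]muleC.
apply: ge0_le_integral => //.
- by move=> x _; rewrite !mule_ge0// lee_fin ?(ltW delta_gt0)// indicE.
- by apply: measurable_funeM; exact/measurable_EFinP/measurable_indic.
- exact: measurable_kernel.
- move=> x _; apply: le_trans (minor x mD).
  by rewrite EFinM -!muleA [nu D * _]muleC.
Qed.

(** Where [p <= level], truncation changes nothing and [minor] applies. Elsewhere the truncated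
    density equals [level], which exceeds the bound [1 / pA] that [nu_dominated] puts on [delta nu]
    relative to [pi]. *)
Lemma trunc_minorization x B : has_density x -> measurable B ->
  (delta * \1_A x)%:E * nu B <= \int[pi]_(y in B) (trunc (x, y))%:E.
Proof.
move=> gx mB; pose D := [set y | (p (x, y) <= level)%R].
have mD : measurable D.
  have -> : D = setT `&` (fun y => p (x, y)) @^-1` `]-oo, level]%classic.
    by rewrite setTI; apply/seteqP; split => y; rewrite /= in_itv.
  exact: (@mpx x measurableT _ (measurable_itv `]-oo, level])).
have mDc := measurableC mD.
have BE : B = (B `&` D) `|` (B `&` ~` D) by rewrite -setIUr setUv setIT.
have disj : [disjoint B `&` D & B `&` ~` D].
  by rewrite disj_set2E; apply/eqP; rewrite -subset0 => y [[_ yD] [_ nyD]].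
have mBD : measurable (B `&` D) by exact: measurableI.
have mBDc : measurable (B `&` ~` D) by exact: measurableI.
rewrite [in leRHS]BE ge0_integral_setU//; last 2 first.
- by apply/measurable_EFinP; exact: measurable_funTS.
- by move=> y _; rewrite lee_fin trunc_ge0.
rewrite [in leLHS]BE measureU//; last by apply/eqP; rewrite -disj_set2E.
have d0 : (0 <= delta * \1_A x)%R by rewrite mulr_ge0 ?(ltW delta_gt0)// indicE.
rewrite ge0_muleDr//; apply: leeD.
- rewrite (_ : \int[pi]_(y in _) _ = P x (B `&` D)); first exact: minor.
  rewrite gx//; apply: eq_integral => y; rewrite inE => -[_ yD].
  by rewrite /trunc min_l.
- apply: (@le_trans _ _ (\int[pi]_(y in B `&` ~` D) level%:E)); last first.
    rewrite le_eqVlt; apply/orP; left; apply/eqP.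
    apply: eq_integral => y; rewrite inE => -[_ /negP nyD].
    by rewrite /trunc min_r// ltW// ltNge.
  rewrite integral_cst// -lee_pdivrMl// muleA -EFinM.
  apply: le_trans (nu_dominated mBDc); rewrite lee_wpmul2r// lee_fin /level.
  rewrite invf_div.
  have i1 : (\1_A x <= 1 :> R)%R by rewrite indicE; case: (_ \in _).
  have := ler_wpM2l (ltW (mulr_gt0 delta_gt0 pA_gt0)) i1.
  have := mulr_ge0 (ltW delta_gt0) (ltW pA_gt0); lra.
Qed.

Definition trunc_mass x : R := fine (\int[pi]_y (trunc (x, y))%:E).
(* [K] times the mass of the residual kernel that [excess] leaves out. *)
Definition killing x : R := Num.max 0%R (K * (trunc_mass x - delta * \1_A x))%R.

Lemma integral_trunc_le (B : set X) x : measurable B ->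
  \int[pi]_(y in B) (trunc (x, y))%:E <= level%:E.
Proof.
move=> mB; apply: (@le_trans _ _ (\int[pi]_y (trunc (x, y))%:E)).
  apply: ge0_subset_integral => //; first exact/measurable_EFinP.
  by move=> y _; rewrite lee_fin trunc_ge0.
apply: (@le_trans _ _ (\int[pi]_y level%:E)).
  apply: ge0_le_integral => //.
  - by move=> y _; rewrite lee_fin trunc_ge0.
  - exact/measurable_EFinP.
  - by move=> y _; rewrite lee_fin trunc_le.
by rewrite integral_cst// [X in _ * X](_ : _ = 1)// mule1.
Qed.

Lemma integral_trunc_ge0 (B : set X) x : 0 <= \int[pi]_(y in B) (trunc (x, y))%:E.
Proof. by apply: integral_ge0 => y _; rewrite lee_fin trunc_ge0. Qed.

Lemma integral_trunc_fin (B : set X) x : measurable B ->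
  \int[pi]_(y in B) (trunc (x, y))%:E \is a fin_num.
Proof.
move=> mB; rewrite ge0_fin_numE ?integral_trunc_ge0//.
by rewrite (le_lt_trans (integral_trunc_le _ mB))// ltry.
Qed.

Lemma trunc_massE x : (trunc_mass x)%:E = \int[pi]_y (trunc (x, y))%:E.
Proof. by rewrite fineK// integral_trunc_fin. Qed.

Lemma killing_ge0 x : (0 <= killing x)%R.
Proof. by rewrite le_max lexx. Qed.

(** At a point with density the truncated part has mass at least [delta 1_A], so the maximum in
    [killing] is its second argument. *)
Lemma killingE x : has_density x ->
  killing x = (K * (trunc_mass x - delta * \1_A x))%R.
Proof.
move=> gx; rewrite /killing max_r// mulr_ge0 ?(ltW K0)// subr_ge0 -lee_fin trunc_massE.
by rewrite (le_trans _ (trunc_minorization gx measurableT))// [X in _ * X](_ : _ = 1) ?mule1.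
Qed.

Lemma measurable_killing : measurable_fun [set: X] killing.
Proof.
apply: measurable_maxr => //; apply: measurable_funM => //; apply: measurable_funB.
  apply: measurableT_comp => //.
  apply: (measurable_fun_fubini_tonelli_F (fun z => (trunc z)%:E)).
    by apply/measurable_EFinP; exact: measurable_trunc.
  by move=> z; rewrite lee_fin trunc_ge0.
by apply: measurable_funM => //; exact: measurable_indic.
Qed.

(** If the truncated mass is exactly [delta 1_A x], the minorization off [D] leaves
    [level * pi D <= delta nu D <= pi D / pA]. As [level] is twice [1 / pA], this forces [pi D = 0],
    and the excess vanishes off [D]. *)
Lemma excess_null x : has_density x -> killing x = 0%R ->
  forall h : X -> \bar R, (forall y, 0 <= h y) -> measurable_fun [set: X] h ->
  \int[pi]_y ((excess (x, y))%:E * h y) = 0.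
Proof.
move=> gx; rewrite killingE// => /eqP; rewrite mulf_eq0 gt_eqF//= subr_eq0 => /eqP bE h h0 mh.
pose D := [set y | (level < p (x, y))%R].
have mD : measurable D.
  have -> : D = setT `&` (fun y => p (x, y)) @^-1` `]level, +oo[%classic.
    by rewrite setTI; apply/seteqP; split => y; rewrite /= in_itv/= andbT.
  exact: (@mpx x measurableT _ (measurable_itv `]level, +oo[)).
have mDc := measurableC mD.
have nuD := fin_num_measure nu _ mD; have piD := fin_num_measure pi _ mD.
have split_mass : (trunc_mass x)%:E = level%:E * pi D + \int[pi]_(y in ~` D) (trunc (x, y))%:E.
  rewrite trunc_massE -(setUv D) ge0_integral_setU//; last 3 first.
  - by rewrite setUv; exact/measurable_EFinP.
  - by move=> y _; rewrite lee_fin trunc_ge0.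
  - by rewrite disj_set2E setICr.
  congr (_ + _); rewrite -integral_cst//; apply: eq_integral => y; rewrite inE => yD.
  by rewrite /trunc min_r// ltW.
have h1 := trunc_minorization gx mDc.
have h2 := nu_dominated mD.
have h3 : nu (~` D) = 1 - nu D by rewrite probability_setC.
have pD0 : pi D = 0.
  move: h1 h2 split_mass; rewrite h3 -(fineK nuD) -(fineK piD).
  rewrite -(fineK (integral_trunc_fin x mDc)) -EFinB -!EFinM -EFinD !lee_fin => h1 h2 [].
  rewrite bE => sm; congr (_%:E).
  have d0 : (0 <= fine (pi D))%R by rewrite fine_ge0.
  have n0 : (0 <= fine (nu D))%R by rewrite fine_ge0.
  have i1 : (\1_A x <= 1 :> R)%R by rewrite indicE; case: (_ \in _).
  have i2 : (delta * \1_A x * fine (nu D) <= delta * fine (nu D))%R.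
    by rewrite ler_wpM2r// ler_piMr// ltW.
  have i3 : (level * fine (pi D) <= delta * fine (nu D))%R by lra.
  have i4 : (2 * fine (pi D) <= delta * pA * fine (nu D))%R.
    have := ler_wpM2l (ltW pA_gt0) i3; rewrite /level.
    have -> : (pA * (2 / pA * fine (pi D)) = 2 * fine (pi D))%R.
      by field; rewrite gt_eqF.
    lra.
  by apply/eqP; rewrite eq_le d0 andbT; lra.
rewrite (ge0_negligible_integral mD _ _ _ pD0)//.
- apply: integral0_eq => y [_ /negP]; rewrite -leNgt => yD.
  by rewrite /excess /trunc min_l// subrr mul0e.
- by apply: emeasurable_funM => //; exact/measurable_EFinP.
- by move=> y _; rewrite mule_ge0// lee_fin excess_ge0.
Qed.

(** * Partial Neumann sums of [K] times the excess kernel *)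

Fixpoint excess_sum (m : nat) (x : X) : \bar R :=
  if m is n.+1
  then 1 + K%:E * \int[pi]_y ((excess (x, y))%:E * excess_sum n y) else 1.
Local Notation V := excess_sum.

Lemma measurable_excess_integral (h : X -> \bar R) : (forall y, 0 <= h y) ->
  measurable_fun [set: X] h ->
  measurable_fun [set: X] (fun x => \int[pi]_y ((excess (x, y))%:E * h y)).
Proof.
move=> h0 mh.
apply: (measurable_fun_fubini_tonelli_F (fun z => (excess z)%:E * h z.2)).
  apply: emeasurable_funM; first by apply/measurable_EFinP; exact: measurable_excess.
  by apply: (measurableT_comp mh); exact: measurable_snd.
by move=> z; rewrite mule_ge0// lee_fin excess_ge0.
Qed.

Lemma excess_sum_ge0 m x : 0 <= V m x.
Proof.
elim: m x => [//|m IHm] x /=; rewrite adde_ge0// mule_ge0// ?lee_fin ?(ltW K0)//.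
by apply: integral_ge0 => y _; rewrite mule_ge0// lee_fin excess_ge0.
Qed.

Lemma measurable_excess_sum m : measurable_fun [set: X] (V m).
Proof.
elim: m => [|m IHm] /=; first exact: measurable_cst.
apply: emeasurable_funD => //; apply: measurable_funeM.
by apply: measurable_excess_integral => // y; exact: excess_sum_ge0.
Qed.

Lemma excess_integral_ge0 h x : (forall y, 0 <= h y) ->
  0 <= \int[pi]_y ((excess (x, y))%:E * h y).
Proof. by move=> h0; apply: integral_ge0 => y _; rewrite mule_ge0// lee_fin excess_ge0. Qed.

Let mexh x (h : X -> \bar R) : measurable_fun [set: X] h ->
  measurable_fun [set: X] (fun y => (excess (x, y))%:E * h y).
Proof. by move=> mh; apply: emeasurable_funM => //; exact/measurable_EFinP. Qed.

Let mtxh x (h : X -> \bar R) : measurable_fun [set: X] h ->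
  measurable_fun [set: X] (fun y => (trunc (x, y))%:E * h y).
Proof. by move=> mh; apply: emeasurable_funM => //; exact/measurable_EFinP. Qed.

Lemma le_excess_integral (h1 h2 : X -> \bar R) x :
  (forall y, 0 <= h1 y) -> (forall y, 0 <= h2 y) ->
  measurable_fun [set: X] h1 -> measurable_fun [set: X] h2 ->
  {ae pi, forall y, h1 y <= h2 y} ->
  \int[pi]_y ((excess (x, y))%:E * h1 y) <= \int[pi]_y ((excess (x, y))%:E * h2 y).
Proof.
move=> h10 h20 m1 m2 h12; apply: ae_ge0_le_integral => //.
- by move=> y _; rewrite mule_ge0// lee_fin excess_ge0.
- exact: mexh.
- by move=> y _; rewrite mule_ge0// lee_fin excess_ge0.
- exact: mexh.
- by apply: filterS h12 => y h12 _; rewrite lee_wpmul2l ?lee_fin ?excess_ge0.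
Qed.

Lemma excess_sumS m x : V m.+1 x = 1 + K%:E * \int[pi]_y ((excess (x, y))%:E * V m y).
Proof. by []. Qed.

Lemma le_excess_sum_step m x : V m x <= V m.+1 x.
Proof.
elim: m x => [|m IHm] x.
  by rewrite /= leeDl// mule_ge0// ?lee_fin ?(ltW K0)// excess_integral_ge0.
rewrite (excess_sumS m) (excess_sumS m.+1) leeD2l// lee_wpmul2l ?lee_fin ?(ltW K0)//.
apply: le_excess_integral;
  [exact: excess_sum_ge0|exact: excess_sum_ge0|
   exact: measurable_excess_sum|exact: measurable_excess_sum|].
by apply: aeW => y; exact: IHm.
Qed.

(** The excess has mass at most [1] at points with density. This crude bound grows with [m]; it
    serves to keep integrals against [V m] finite. *)
Lemma excess_sum_ae_bounded m : exists c : R, (0 <= c)%R /\ {ae pi, forall x, V m x <= c%:E}.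
Proof.
elim: m => [|m [c [c0 IHm]]]; first by exists 1%R; split => //; apply: aeW.
exists (1 + K * c)%R; split; first by rewrite addr_ge0// mulr_ge0// ltW.
apply: filterS ae_density => x gx.
rewrite /= EFinD leeD2l// EFinM lee_wpmul2l ?lee_fin ?(ltW K0)//.
apply: (@le_trans _ _ (\int[pi]_y ((excess (x, y))%:E * c%:E))).
  by apply: le_excess_integral => // [y|]; [exact: excess_sum_ge0|exact: measurable_excess_sum].
apply: (@le_trans _ _ (\int[P x]_y c%:E)); last first.
  by rewrite integral_cst// kernel_setT mule1.
rewrite (kernel_integral_density (h := fun=> c%:E) gx)// leeDl//.
by apply: integral_ge0 => y _; rewrite mule_ge0// lee_fin trunc_ge0.
Qed.

Hypothesis bmf_phi : forall n, bmf (phi n).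
Hypothesis phi_ge1 : forall n x, (1 <= phi n x)%R.
Hypothesis phi_nd : forall n x, (phi n x <= phi n.+1 x)%R.
Hypothesis phi_drift : forall n x, (K * residual P nu A delta (phi n) x <= phi n.+1 x)%R.
Hypothesis phi_pi : forall n, (\int[pi]_x phi n x <= Cpi)%R.

Let phi_ge0 n x : (0 <= phi n x)%R. Proof. exact: le_trans ler01 (phi_ge1 n x). Qed.
Let mphi n : measurable_fun [set: X] (fun x => (phi n x)%:E).
Proof. exact/measurable_EFinP/bmf_meas. Qed.

(** The minorization is applied to [g - 1] only. The constant part keeps the whole truncated mass,
    and this is what leaves [killing] over in the drift. *)
Lemma trunc_integral_ge x (g : X -> R) : has_density x -> bmf g ->
  (forall y, (1 <= g y)%R) ->
  (trunc_mass x + delta * \1_A x * (\int[nu]_y g y - 1))%:E <=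
    \int[pi]_y ((trunc (x, y))%:E * (g y)%:E).
Proof.
move=> gx bg g1.
have bg1 : bmf (fun y => g y - 1)%R by apply: bmfB => //; exact: bmf_cst.
have g10 y : (0 <= g y - 1)%R by rewrite subr_ge0.
have mg1 : measurable_fun [set: X] (fun y => (g y - 1)%:E) by exact/measurable_EFinP/bmf_meas.
have t0 y : (0 <= trunc (x, y))%R by exact: trunc_ge0.
have d0 : (0 <= delta * \1_A x)%R by rewrite mulr_ge0 ?(ltW delta_gt0)// indicE.
have h1 : (delta * \1_A x * (\int[nu]_y g y - 1))%:E <=
    \int[pi]_y ((trunc (x, y))%:E * (g y - 1)%:E).
  rewrite -(@integral_density _ _ _ pi (density pi t0 (mtx x)))//.
  have -> : (\int[nu]_y g y - 1 = \int[nu]_y (g y - 1))%R.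
    by rewrite expB ?exp_cst//; exact: bmf_cst.
  rewrite EFinM expE//; apply: ge0_le_integral_measure => // B mB.
  exact: trunc_minorization.
have -> : \int[pi]_y ((trunc (x, y))%:E * (g y)%:E) =
    (trunc_mass x)%:E + \int[pi]_y ((trunc (x, y))%:E * (g y - 1)%:E).
  rewrite trunc_massE -ge0_integralD//.
  - by apply: eq_integral => y _; rewrite -!EFinM -EFinD; congr (_%:E); ring.
  - by move=> y _; rewrite lee_fin.
  - exact/measurable_EFinP.
  - by move=> y _; rewrite -EFinM lee_fin mulr_ge0.
  - exact: mtxh.
by rewrite EFinD leeD2l.
Qed.

(** Splitting [P] into excess and truncated part, [Q (phi j)] is at least the excess integral of
    [phi j] plus [trunc_mass - delta 1_A], by [trunc_integral_ge]; then [phi_drift] applies. *)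
Lemma killing_drift x j : has_density x ->
  K%:E * \int[pi]_y ((excess (x, y))%:E * (phi j y)%:E) + (killing x)%:E
    <= (phi j.+1 x)%:E.
Proof.
move=> gx; have tge := trunc_integral_ge gx (bmf_phi j) (phi_ge1 j).
have TE := kernel_integral_density (h := fun y => (phi j y)%:E) gx.
have {TE} := TE (fun y => phi_ge0 j y) (mphi j).
rewrite integral_kernel_EFin//.
have e0 : 0 <= \int[pi]_y ((excess (x, y))%:E * (phi j y)%:E).
  by apply: excess_integral_ge0 => y; rewrite lee_fin.
have t0 : 0 <= \int[pi]_y ((trunc (x, y))%:E * (phi j y)%:E).
  by apply: integral_ge0 => y _; rewrite -EFinM lee_fin mulr_ge0// trunc_ge0.
move: e0 t0 tge.
set e := \int[pi]_y _; set t := \int[pi]_y _ => e0 t0 tge TE.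
have efin : e \is a fin_num.
  by rewrite ge0_fin_numE// (@le_lt_trans _ _ (e + t)) ?leeDl// -TE ltry.
have tfin : t \is a fin_num.
  by rewrite ge0_fin_numE// (@le_lt_trans _ _ (e + t)) ?leeDr// -TE ltry.
move: tge TE; rewrite -(fineK efin) -(fineK tfin) -EFinD -EFinM -EFinD !lee_fin => tge [TE].
apply: le_trans (phi_drift j x); rewrite /residual TE killingE//.
by rewrite -mulrDr ler_wpM2l ?(ltW K0)//; lra.
Qed.

(** With [a] the integral of [V m] against [K E (phi j)], [h1] bounds [a] plus the killing term by
    [IV (phi j.+1)], [h3] replaces [phi j.+1] by [phi j] at cost [1], and [h2] bounds [IV (phi j)]
    by [pi (phi j) + a]. The finite [a] cancels. *)
Lemma weighted_killing_bound m : \int[pi]_x (V m x * (killing x)%:E) <= (Cpi + 1)%:E.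
Proof.
have [c [c0 Vc]] := excess_sum_ae_bounded m.
(* The means of [phi] increase and are bounded by [Cpi], so some increment is small compared with
   [c]; otherwise [c] times the mean would grow at least like [n]. *)
have [j hj] : exists j, (c * (\int[pi]_x phi j.+1 x - \int[pi]_x phi j x) <= 1)%R.
  apply: contrapT => /forallNP hj.
  have c1 : (0 < c)%R.
    by rewrite lt_neqAle c0 andbT eq_sym; apply/eqP => c00; apply: (hj 0%N); rewrite c00 mul0r.
  have grow n : (n%:R <= c * \int[pi]_x phi n x)%R.
    elim: n => [|n IHn]; first by rewrite mulr_ge0//; apply: Rintegral_ge0.
    have /negP := hj n; rewrite -ltNge -natr1; lra.
  have := archi_boundP (x := c * Cpi)%R.
  rewrite mulr_ge0//; last by rewrite (le_trans _ (phi_pi 0))//; apply: Rintegral_ge0.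
  move=> /(_ isT); rewrite ltNge => /negP; apply.
  by rewrite (le_trans (grow _))// ler_wpM2l.
pose IV (f : X -> R) := \int[pi]_x (V m x * (f x)%:E).
have mVf (f : X -> R) : measurable_fun [set: X] f ->
    measurable_fun [set: X] (fun x => V m x * (f x)%:E).
  by move=> mf; apply: emeasurable_funM; [exact: measurable_excess_sum|exact/measurable_EFinP].
have Vf0 (f : X -> R) x : (0 <= f x)%R -> 0 <= V m x * (f x)%:E.
  by move=> f0; rewrite mule_ge0// excess_sum_ge0.
have IVle (f : X -> R) : bmf f -> (forall x, (0 <= f x)%R) ->
    IV f <= (c * \int[pi]_x f x)%:E.
  move=> bf f0; rewrite EFinM expE// -ge0_integralZl//; last 2 first.
  - exact/measurable_EFinP/bmf_meas.
  - by move=> x _; rewrite lee_fin.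
  apply: ae_ge0_le_integral => //.
  - by move=> x _; exact: Vf0.
  - by apply: mVf; exact: bmf_meas.
  - by move=> x _; rewrite -EFinM lee_fin mulr_ge0.
  - by apply: measurable_funeM; exact/measurable_EFinP/bmf_meas.
  - by apply: filterS Vc => x Vc _; rewrite lee_wpmul2r// lee_fin.
pose E x := \int[pi]_y ((excess (x, y))%:E * (phi j y)%:E).
have E0 x : 0 <= E x by apply: excess_integral_ge0 => y; rewrite lee_fin.
have mE : measurable_fun [set: X] E.
  by apply: measurable_excess_integral => // y; rewrite lee_fin.
pose a := \int[pi]_x (V m x * (K%:E * E x)).
have mKE : measurable_fun [set: X] (fun x => V m x * (K%:E * E x)).
  by apply: emeasurable_funM; [exact: measurable_excess_sum|exact: measurable_funeM].
have KE0 x : 0 <= V m x * (K%:E * E x).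
  by rewrite mule_ge0 ?excess_sum_ge0// mule_ge0// lee_fin ltW.
have a0 : 0 <= a by apply: integral_ge0.
have h1 : a + IV killing <= IV (phi j.+1).
  rewrite /a /IV -ge0_integralD//; last 2 first.
  - by move=> x _; apply: Vf0; exact: killing_ge0.
  - by apply: mVf; exact: measurable_killing.
  apply: ae_ge0_le_integral => //.
  - by move=> x _; rewrite adde_ge0//; apply: Vf0; exact: killing_ge0.
  - by apply: emeasurable_funD => //; apply: mVf; exact: measurable_killing.
  - by move=> x _; exact: Vf0.
  - by apply: mVf; exact: bmf_meas.
  - apply: filterS ae_density => x gx _.
    rewrite -ge0_muleDr ?lee_fin ?killing_ge0//; last by rewrite mule_ge0// lee_fin ltW.
    by rewrite lee_wpmul2l ?excess_sum_ge0// killing_drift.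
have h2 : IV (phi j) <= (\int[pi]_x phi j x)%:E + a.
  (* Tonelli and the symmetry of the excess move the kernel from [phi j] onto [V m], where it
     rebuilds [V m.+1 - 1]. *)
  have -> : a = \int[pi]_x (K%:E * \int[pi]_y ((excess (x, y))%:E * V m y) * (phi j x)%:E).
    pose h (z : X * X) := V m z.1 * (K%:E * ((excess z)%:E * (phi j z.2)%:E)).
    have h0 z : 0 <= h z.
      by rewrite mule_ge0 ?excess_sum_ge0// mule_ge0 ?lee_fin ?(ltW K0)// mulr_ge0// excess_ge0.
    have mh : measurable_fun [set: X * X] h.
      apply: emeasurable_funM.
        by apply: (measurableT_comp (measurable_excess_sum m)); exact: measurable_fst.
      apply: measurable_funeM; apply: emeasurable_funM.
        by apply/measurable_EFinP; exact: measurable_excess.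
      by apply: (measurableT_comp (mphi j)); exact: measurable_snd.
    have := fubini_tonelli (m1 := pi) (m2 := pi) h mh h0; rewrite /h /=.
    under eq_integral => x _.
      rewrite ge0_integralZl//; last 3 first.
      - by apply: measurable_funeM; apply: mexh.
      - by move=> y _; rewrite mule_ge0 ?lee_fin ?(ltW K0)// mulr_ge0// excess_ge0.
      - exact: excess_sum_ge0.
      rewrite ge0_integralZl//; last 3 first.
      - exact: mexh.
      - by move=> y _; rewrite -EFinM lee_fin mulr_ge0// excess_ge0.
      - by rewrite lee_fin ltW.
      over.
    rewrite -/a => ->.
    apply: eq_integral => y _.
    rewrite -ge0_integralZl//; last 3 first.
    - by apply: mexh; exact: measurable_excess_sum.
    - by move=> x _; rewrite mule_ge0 ?excess_sum_ge0// lee_fin excess_ge0.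
    - by rewrite lee_fin ltW.
    rewrite -ge0_integralZr//; last 3 first.
    - by apply: measurable_funeM; apply: mexh; exact: measurable_excess_sum.
    - move=> x _; rewrite mule_ge0 ?lee_fin ?(ltW K0)// mule_ge0 ?excess_sum_ge0//.
      by rewrite lee_fin excess_ge0.
    - by rewrite lee_fin.
    apply: eq_integral => x _; rewrite excess_sym.
    by rewrite muleCA -!muleA [V m x * _]muleCA.
  rewrite expE// -ge0_integralD//; last 3 first.
  - by move=> x _; rewrite lee_fin.
  - move=> x _; rewrite mule_ge0 ?lee_fin// mule_ge0 ?lee_fin ?(ltW K0)//.
    by apply: excess_integral_ge0; exact: excess_sum_ge0.
  - apply: emeasurable_funM => //; apply: measurable_funeM.
    by apply: measurable_excess_integral; [exact: excess_sum_ge0|exact: measurable_excess_sum].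
  apply: ge0_le_integral => //.
  - by move=> x _; exact: Vf0.
  - by apply: mVf; exact: bmf_meas.
  - apply: emeasurable_funD => //; apply: emeasurable_funM => //; apply: measurable_funeM.
    by apply: measurable_excess_integral; [exact: excess_sum_ge0|exact: measurable_excess_sum].
  move=> x _; rewrite -[X in X + _]mul1e -ge0_muleDl//; last first.
    rewrite mule_ge0 ?lee_fin ?(ltW K0)//.
    by apply: excess_integral_ge0; exact: excess_sum_ge0.
  by rewrite -excess_sumS lee_wpmul2r ?lee_fin// le_excess_sum_step.
have h3 : IV (phi j.+1) <= IV (phi j) + (c * (\int[pi]_x phi j.+1 x - \int[pi]_x phi j x))%:E.
  have bd : bmf (fun x => phi j.+1 x - phi j x)%R by exact: bmfB.
  have d0 x : (0 <= phi j.+1 x - phi j x)%R by rewrite subr_ge0.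
  have -> : IV (phi j.+1) = IV (phi j) + IV (fun x => phi j.+1 x - phi j x)%R.
    rewrite /IV -ge0_integralD//.
    - apply: eq_integral => x _; rewrite -ge0_muleDr ?lee_fin//.
      by rewrite -EFinD addrC subrK.
    - by move=> x _; exact: Vf0.
    - by apply: mVf; exact: bmf_meas.
    - by move=> x _; exact: (Vf0 (fun x => phi j.+1 x - phi j x)%R x (d0 x)).
    - by apply: (mVf (fun x => phi j.+1 x - phi j x)%R); exact: bmf_meas.
  by rewrite leeD2l// -expB//; exact: IVle.
have afin : a \is a fin_num.
  rewrite ge0_fin_numE// (@le_lt_trans _ _ (IV (phi j.+1)))//.
    rewrite (le_trans _ h1)// leeDl//; apply: integral_ge0 => x _; apply: Vf0.
    exact: killing_ge0.
  by rewrite (le_lt_trans (IVle _ _ _))// ltry.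
have : a + IV killing <= a + (Cpi + 1)%:E.
  apply: (le_trans h1); apply: (le_trans h3).
  apply: (@le_trans _ _ (((\int[pi]_x phi j x)%:E + a) + 1%:E)).
    by rewrite leeD.
  by rewrite addeAC addeC leeD2l// -EFinD lee_fin lerD2r.
by rewrite leeD2lE.
Qed.

(** The supremum of [V m] times [killing] is integrable, hence finite almost everywhere. Where
    [killing] is positive one divides by it; where it is zero the excess is null and [V m = 1]. *)
Lemma excess_sum_ae_sup : {ae pi, forall x, exists c : R, forall m, V m x <= c%:E}.
Proof.
pose h m x := V m x * (killing x)%:E.
have h0 m x : 0 <= h m x by rewrite mule_ge0 ?excess_sum_ge0// lee_fin killing_ge0.
have hnd m x : h m x <= h m.+1 x.
  by rewrite /h lee_wpmul2r ?le_excess_sum_step// lee_fin killing_ge0.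
have mh m : measurable_fun [set: X] (h m).
  apply: emeasurable_funM; first exact: measurable_excess_sum.
  exact/measurable_EFinP/measurable_killing.
have intW : pi.-integrable [set: X] (sup_seq h).
  apply/integrableP; split; first exact: measurable_sup_seq.
  under eq_integral do rewrite gee0_abs ?sup_seq_ge0//.
  apply: (@le_lt_trans _ _ (Cpi + 1)%:E); last exact: ltry.
  by apply: integral_sup_seq_le => // m; exact: weighted_killing_bound.
have := integrable_ae measurableT intW.
apply: filterS2 ae_density => x gx /(_ Logic.I) Wfin.
have [k0|kn0] := eqVneq (killing x) 0%R.
  exists 1%R => -[|m]; first by [].
  rewrite excess_sumS excess_null// ?mule0 ?adde0//; first exact: excess_sum_ge0.
  exact: measurable_excess_sum.
have kp : (0 < killing x)%R by rewrite lt_neqAle eq_sym kn0 killing_ge0.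
exists (fine (sup_seq h x) / killing x)%R => m.
rewrite EFinM fineK// lee_pdivlMr//.
exact: (@sup_seq_ub _ _ _ h).
Qed.

(** The truncated part is at most [level] times the [L^1] norm, and the excess part uses the
    induction hypothesis almost everywhere under [pi]. In the constant, [2] covers [n = 0], and
    [2 * level * K] covers the truncated part, where [K] pays for the shift from [K ^- n] to
    [K ^- n.+1]. *)
Lemma pointwise_decay (f : X -> R) : bmf f -> (forall x, (`|f x| <= 2)%R) ->
  (forall n, (\int[pi]_x `|iter n T f x| <= 2 * K ^- n)%R) ->
  forall n x, has_density x ->
  (`|iter n T f x|)%:E <= ((2 + 2 * level * K) * K ^- n)%:E * V n x.
Proof.
move=> bf f2 fn; elim=> [|n IHn] x gx.
  rewrite expr0 invr1 mulr1 mule1 lee_fin (le_trans (f2 x))// lerDl.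
  by rewrite mulr_ge0 ?(ltW K0)// mulr_ge0// ltW.
set C := (2 + 2 * level * K)%R.
have C0 : (0 <= C)%R by rewrite addr_ge0// mulr_ge0 ?(ltW K0)// mulr_ge0// ltW.
have Kn0 i : (0 <= K ^- i)%R by rewrite invr_ge0 exprn_ge0// ltW.
have bn := bmf_iter_kop P n bf; have ban := bmf_abs bn.
have man : measurable_fun [set: X] (fun y => `|iter n T f y|%:E).
  exact/measurable_EFinP/bmf_meas.
apply: (@le_trans _ _ (T (fun y => `|iter n T f y|) x)%:E).
  by rewrite lee_fin /= /kop le_norm_exp//; exact: kernel_setT.
rewrite -integral_kernel_EFin// kernel_integral_density//.
rewrite excess_sumS ge0_muleDr//; last first.
  by rewrite mule_ge0 ?lee_fin ?(ltW K0)//; apply: excess_integral_ge0; exact: excess_sum_ge0.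
rewrite mule1 addeC; apply: leeD.
  apply: (@le_trans _ _ (\int[pi]_y (level%:E * `|iter n T f y|%:E))).
    apply: ge0_le_integral => //.
    - by move=> y _; rewrite -EFinM lee_fin mulr_ge0// trunc_ge0.
    - exact: mtxh.
    - exact: measurable_funeM.
    - by move=> y _; rewrite lee_wpmul2r// lee_fin trunc_le.
  rewrite ge0_integralZl//; last by rewrite lee_fin ltW.
  rewrite -expE// -EFinM lee_fin.
  apply: (@le_trans _ _ (level * (2 * K ^- n))%R).
    by rewrite ler_wpM2l// ltW.
  rewrite exprS invfM /C; have := Kn0 n; move: (K ^- n)%R => k k0.
  have -> : ((2 + 2 * level * K) * (K^-1 * k) = 2 * K^-1 * k + level * (2 * k))%R.
    by field; rewrite gt_eqF.
  by rewrite lerDr mulr_ge0// mulr_ge0// invr_ge0 ltW.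
apply: (@le_trans _ _ (\int[pi]_y ((excess (x, y))%:E * ((C * K ^- n)%:E * V n y)))).
  apply: le_excess_integral => //.
  - by move=> y; rewrite mule_ge0 ?excess_sum_ge0// lee_fin mulr_ge0.
  - by apply: measurable_funeM; exact: measurable_excess_sum.
  - by apply: filterS ae_density => y; exact: IHn.
under eq_integral do rewrite muleCA.
rewrite ge0_integralZl//; last 3 first.
- by apply: mexh; exact: measurable_excess_sum.
- by move=> y _; rewrite mule_ge0 ?excess_sum_ge0// lee_fin excess_ge0.
- by rewrite lee_fin mulr_ge0.
rewrite muleA -EFinM le_eqVlt; apply/orP; left; apply/eqP; congr (_%:E * _).
by rewrite exprS invfM; move: (K ^- n)%R => k; field; rewrite gt_eqF.
Qed.

End truncated_density.

(** * Geometric convergence from almost every starting point *)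

Theorem proposition3p3 (d d' : measure_display) (R : realType)
    (X : measurableType d) (Omega : measurableType d')
    (P : R.-pker X ~> X) (pi : probability X R)
    (Pr : X -> probability Omega R) (Phi : nat -> {mfun Omega >-> X})
    (X_cg : countably_generated X)
    (chain : is_markov_chain P Pr Phi)
    (pi_inv : invariant_measure P pi)
    (pi_irr : irreducible pi Pr Phi)
    (abs_cont : forall n x, (0 < n)%N -> nstep Pr Phi n x `<< pi)
    (P_rev : reversible P pi)
    (P_nonneg : nonneg_definite P pi)
    (A : set X) (A_meas : measurable A) (A_pos : (0 < pi A)%E)
    (kappa : R) (kappa_gt1 : 1 < kappa)
    (delta : R) (delta_gt0 : 0 < delta) (nu : probability X R)
    (minor : forall x B, measurable B ->
       ((delta * \1_A x)%:E * nu B <= P x B)%E)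
    (L_fin : (sup_hitting_moment Pr Phi A kappa < +oo)%E) :
  let L := fine (sup_hitting_moment Pr Phi A kappa) in
  let K := rate kappa delta L in
  {ae pi, forall x, exists C : R, forall n : nat,
     (var_dist (nstep Pr Phi n x) pi <= (C * K ^- n)%:E)%E}.
Proof.
move=> L K.
have piAfin : pi A \is a fin_num by exact: fin_num_measure.
pose pA := fine (pi A).
have pAE : pi A = pA%:E by rewrite fineK.
have pA_gt0 : 0 < pA by rewrite -lte_fin -pAE.
have A_nonempty : A !=set0.
  apply/set0P/eqP => A0; move: A_pos; rewrite A0.
  by rewrite [X in (0 < X)%E](_ : _ = 0%E) ?ltxx//; exact: measure0.
have hitL m x (Ax : A x) : kappa * kop P (hit_moment P A kappa m) x <= L.
  exact: (kop_hit_moment_le_sup chain A_meas kappa_gt1 m Ax L_fin).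
have minorF := kop_minorization delta_gt0 minor.
pose phi := hit_moment P A K.
have K_gt1 : 1 < K := rate_gt1 kappa_gt1 delta_gt0 minorF A_nonempty hitL.
have K_gt0 : 0 < K := lt_trans ltr01 K_gt1.
have drift := hit_moment_drift A_meas kappa_gt1 delta_gt0 minorF A_nonempty hitL.
have bphi m : bmf (phi m) by exact: bmf_hit_moment.
have phi_ge1 m x : 1 <= phi m x by apply: hit_moment_ge1 => //; exact: ltW.
have phi_ge0 m x : 0 <= phi m x by exact: le_trans ler01 (phi_ge1 m x).
have phi_nd m x : phi m x <= phi m.+1 x by apply: le_hit_moment_step => //; exact: ltW.
have L_ge0 : 0 <= L.
  by rewrite (le_trans (ltW (lt_trans ltr01 kappa_gt1)))// (kappa_le_moment A_nonempty hitL).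
(* Off [A] the recursion of [phi] is an equality; on [A] the left side is at most [L]. *)
have driftT m x : K * kop P (phi m) x <= phi m.+1 x + L.
  have [Ax|Ax] := pselect (A x); last by rewrite /phi hit_moment_out// lerDl.
  rewrite (le_trans (kop_hit_moment_le A_meas kappa_gt1 delta_gt0 minorF A_nonempty hitL m Ax))//.
  by rewrite lerDr.
(* The set where [phi] stays bounded is absorbing and contains [A], on which [phi = 1]. *)
have full : pi (~` finite_drift phi) = 0%E.
  apply: (absorbing_full chain pi_irr).
  - exact: measurable_finite_drift.
  - have [x Ax] := A_nonempty; exists x; rewrite /finite_drift /=.
    apply: (@le_lt_trans _ _ 1%:E); last exact: ltry.
    by apply: sup_seq_le => // m; rewrite lee_fin /phi hit_moment_in.
  - exact: (finite_drift_absorbing bphi phi_ge0 phi_nd K_gt1 driftT).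
have phi_pi m : \int[pi]_x phi m x <= L / (K - 1).
  exact: (drift_integral_le pi_inv bphi phi_ge0 phi_nd K_gt1 L_ge0 driftT full).
have phi_nu := nu_hit_moment_le A_meas kappa_gt1 delta_gt0 minorF A_nonempty hitL.
have ac x B (mB : measurable B) : pi B = 0%E -> P x B = 0%E.
  move=> piB0; rewrite -(nstep1 chain)//.
  by have /null_content_dominatesP := abs_cont 1%N x isT; exact.
have decay f : bmf f -> (forall x, `|f x| <= 2) -> \int[pi]_x f x = 0 ->
    forall n, \int[pi]_x `|iter n (kop P) f x| <= 2 * K ^- n.
  move=> bf f2 f0; apply: (@norm_iter_kop_mean_le _ _ _ _ _ nu A delta K phi (L / (K - 1))
    (L / (delta * K)) pA) => //.
  - by move=> g bg; exact: exp_kop_invariant.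
  - by move=> g h bg bh; exact: exp_kop_reversible.
  - by move=> g bg; exact: exp_kop_psd.
  - by apply: EFin_inj; rewrite exp_indic//; exact: probability_setT.
have [p [p0 mp psym pP]] := kernel_density X_cg P_rev ac.
have pP' := pP.
have := excess_sum_ae_sup A_meas pi_inv pA_gt0 pAE delta_gt0 K_gt1 minor p0 mp psym pP
  bphi phi_ge1 phi_nd drift phi_pi.
apply: filterS2 pP => x gx [c Vc].
(* Here [c] bounds all the sums [excess_sum m x] at this starting point. *)
exists ((2 + 2 * level pA * K) * c) => n.
apply: ge_ereal_sup => _ [f [mf f1] <-].
have bf : bmf f by split=> //; exists 1.
have pi1 : pi [set: X] = 1%E by exact: probability_setT.
(* Centring makes [pi g = 0], turns the bound [1] into [2], and makes the difference of the two
   integrals equal to the [n]-th iterate of the kernel on [g]. *)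
pose g y := f y - \int[pi]_z f z.
have bg : bmf g by apply: bmfB => //; exact: bmf_cst.
have g2 y : `|g y| <= 2.
  rewrite (le_trans (ler_normB _ _))// (_ : 2 = 1 + 1)// lerD//.
  exact: exp_norm_le.
have g0 : \int[pi]_y g y = 0.
  by rewrite expB ?exp_cst ?subrr//; exact: bmf_cst.
have n1 : nstep Pr Phi n x [set: X] = 1%E by exact: probability_setT.
rewrite -!expE// -EFinB /=.
have -> : \int[nstep Pr Phi n x]_y f y - \int[pi]_y f y = iter n (kop P) g x.
  by rewrite -(exp_nstep chain)// expB ?exp_cst//; exact: bmf_cst.
rewrite (le_trans (pointwise_decay pA_gt0 K_gt1 p0 mp pP' bg g2 (decay _ bg g2 g0) n gx))//.
rewrite (mulrAC _ c) (EFinM _ c); apply: lee_wpmul2l; last exact: Vc.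
rewrite lee_fin mulr_ge0 ?invr_ge0 ?exprn_ge0 ?(ltW K_gt0)//.
by rewrite addr_ge0// mulr_ge0 ?(ltW K_gt0)// mulr_ge0// /level divr_ge0// ltW.
Qed.
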